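(* Let $l:[0,T]\to\mathbb R\cup\{\infty\}$ be a continuous function with $l(0)\neq0$, and let $a\in\mathbb R\setminus\{0\}$. Then there exist $\tau>0$ and a curve $\gamma:(0,\tau)\to(\mathbb H,0,\infty)$ such that $LC_\gamma(t)=l(t)$ for $t\in(0,\tau)$ and $\gamma$ has scale $a$ at $0$.
   Context: $\mathbb H$ is the upper half-plane; $\mathbb R\cup\{\infty\}$ carries its one-point compactification topology. $\gamma:(0,\tau)\to(\mathbb H,0,\infty)$ means $\gamma[0,\tau)$ is a simple curve with $\gamma(0,\tau)\subset\mathbb H$, $\gamma(0)=0$. Loewner framework: with $\gamma$ parametrized by halfplane capacity, $g_t:\mathbb H\setminus\gamma(0,t]\to\mathbb H$ is conformal with $g_t(z)=z+\frac{2t}{z}+O(1/z^2)$ at $\infty$ and solves $\partial_tg_t(z)=2/(g_t(z)-\lambda(t))$, $g_0(z)=z$, where $\lambda(t)=g_t(\gamma(t))$ is the driving function; $\gamma$ is generated by $\lambda$. Loewner curvature (in this halfplane-capacity setting): $LC_\gamma(t)=\lambda'(t)^3/\lambda''(t)$, with $0/0:=0$ and $x/0:=\infty$ for $x\ne0$. Scale: if $\gamma$ has driving function $\lambda\in C^2[0,\tau)$ with $\lambda'(0)\neq0$, the scale of $\gamma$ at $0$ is $\frac23\lambda'(0)$ (the coefficient of $t$ in the expansion $\gamma(t)=2i\sqrt t+\frac23\lambda'(0)t+O(t^{3/2})$). *)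

(* Defs.v *)
From Stdlib Require Import Reals Lra.
From Coquelicot Require Import Coquelicot.
Open Scope R_scope.

(* R ∪ {∞} (one point compactification): None stands for ∞. *)
Definition Rinf := option R.

Definition cont_inf_at (T : R) (l : R -> Rinf) (t : R) : Prop :=
  match l t with
  | Some r => forall eps, 0 < eps -> exists delta, 0 < delta /\
      forall s, 0 <= s <= T -> Rabs (s - t) < delta ->
        exists r', l s = Some r' /\ Rabs (r' - r) < eps
  | None => forall M, exists delta, 0 < delta /\
      forall s, 0 <= s <= T -> Rabs (s - t) < delta ->
        l s = None \/ exists r', l s = Some r' /\ M < Rabs r'
  end.

Definition cont_inf_on (T : R) (l : R -> Rinf) : Prop :=
  forall t, 0 <= t <= T -> cont_inf_at T l t.

Definition has_deriv_on (f f' : R -> R) (a b : R) : Prop :=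
  forall t, a <= t < b -> forall eps, 0 < eps -> exists delta, 0 < delta /\
    forall s, a <= s < b -> Rabs (s - t) < delta ->
      Rabs (f s - f t - f' t * (s - t)) <= eps * Rabs (s - t).

Definition cont_on (f : R -> R) (a b : R) : Prop :=
  forall t, a <= t < b -> forall eps, 0 < eps -> exists delta, 0 < delta /\
    forall s, a <= s < b -> Rabs (s - t) < delta -> Rabs (f s - f t) < eps.

Definition C2_on (lam lam1 lam2 : R -> R) (tau : R) : Prop :=
  has_deriv_on lam lam1 0 tau /\ has_deriv_on lam1 lam2 0 tau /\ cont_on lam2 0 tau.

Definition LC_value (d1 d2 : R) : Rinf :=
  if Req_EM_T d2 0 then (if Req_EM_T d1 0 then Some 0 else None)
  else Some (d1 ^ 3 / d2).

Definition inH (z : Complex.C) : Prop := 0 < Im z.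

Definition slit_dom (gam : R -> Complex.C) (t : R) (z : Complex.C) : Prop :=
  inH z /\ forall s, 0 < s <= t -> z <> gam s.

Definition curve_H (gam : R -> Complex.C) (tau : R) : Prop :=
  (forall t, 0 <= t < tau -> forall eps, 0 < eps -> exists delta, 0 < delta /\
     forall s, 0 <= s < tau -> Rabs (s - t) < delta -> Cmod (gam s - gam t)%C < eps)
  /\ (forall s t, 0 <= s < tau -> 0 <= t < tau -> gam s = gam t -> s = t)
  /\ (forall t, 0 < t < tau -> inH (gam t))
  /\ gam 0 = RtoC 0.

(* γ (parametrized by halfplane capacity) is generated by the driving function λ
   on [0,τ): there are conformal maps g_t : H \ γ(0,t] -> H with
   g_t(z) = z + 2t/z + O(1/z^2) at ∞, solving the Loewner equation
   ∂_t g_t(z) = 2/(g_t(z) - λ(t)), g_0 = id, and λ(t) = g_t(γ(t))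
   (g_t extended by continuity to the tip γ(t)). *)
Definition generated_by (gam : R -> Complex.C) (lam : R -> R) (tau : R) : Prop :=
  exists g : R -> Complex.C -> Complex.C,
    (forall z, g 0 z = z) /\
    (forall t, 0 <= t < tau ->
       (forall z, slit_dom gam t z ->
          exists d, @is_derive C_AbsRing C_NormedModule (g t) z d) /\
       (forall z, slit_dom gam t z -> inH (g t z)) /\
       (forall z w, slit_dom gam t z -> slit_dom gam t w -> g t z = g t w -> z = w) /\
       (forall w, inH w -> exists z, slit_dom gam t z /\ g t z = w) /\
       (* hydrodynamic normalization with halfplane capacity 2t *)
       (exists M R0, 0 < R0 /\ forall z, slit_dom gam t z -> R0 < Cmod z ->
          Cmod (g t z - z - RtoC (2 * t) / z)%C <= M / (Cmod z ^ 2)) /\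
       (forall eps, 0 < eps -> exists delta, 0 < delta /\
          forall z, slit_dom gam t z -> Cmod (z - gam t)%C < delta ->
            Cmod (g t z - RtoC (lam t))%C < eps)) /\
    (forall t z, 0 < t < tau -> slit_dom gam t z ->
       @is_derive R_AbsRing C_R_NormedModule (fun s => g s z) t
         (RtoC 2 / (g t z - RtoC (lam t)))%C).

(* Main.v *)
Require Import Defs.
From Stdlib Require ssreflect.
From Stdlib Require Import Reals Lra Psatz ClassicalEpsilon.
From Coquelicot Require Import Coquelicot.
Open Scope R_scope.

(** The curvature condition is [(lam1^-2)' = -2 / l] with [1 / oo = 0], solved by
    [lam1 = mu0 / sqrt (1 - 2 mu0^2 int 1/l)] with [mu0 = 3 a / 2]. It remains to show that a
    [C^1] function [lam] with [|lam1| <= M] generates a simple curve up to time [1 / M^2].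

    In the coordinate [u = g - lam] the Loewner equation reads [u' = 2 / u - lam1], so that
    [(u^2)' = 4 - 2 lam1 u]. For two solutions [u] and [w] the quantity [u^2 - w^2] is multiplied
    by the exponential of [-2 int lam1 / (u + w)]. Solutions that end near [0] at time [t] satisfy
    [Im u(s) >= sqrt (2 (t - s))], which makes this integral bounded: [|u^2 - w^2|] is preserved
    up to a constant, even when [u] ends at the singular point [0]. Hence the initial points of
    solutions ending at [i / n] at time [t] converge to a point [gam t], the only one whose
    solution hits [0] at time [t]; the same comparison yields continuity of [gam], survival up to
    time [t] of all points off [gam (0, t]], and the limit of [g_t] at the tip. *)

(** * Picard iteration *)

(** Why squares: the difference [u - w] itself has logarithmic derivative [-2 / (u w)], which is of
    order [1 / (t - s)] when both solutions collapse at time [t], hence not integrable. For the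
    squares the coefficient is only of order [(t - s)^(-1/2)]. The height bound comes from the real
    part. [Re (2 / u)] has the sign of [Re u], so backward in time from the imaginary axis only the
    drift [lam1] can push a solution away, and [|Re u(s)| <= M (t - s)]. While [M^2 t <= 1], this
    makes [Re (u^2)] grow at a speed between 2 and 6: hence the time limit [1 / M^2]. On the side of
    the driving function, [l(0) <> 0] makes [1 / l] continuous near 0, the value infinity included.
    Infinite curvature becomes [lam1' = 0] with [lam1 <> 0], so a single equation
    [lam1' = lam1^3 / l] covers all cases, and shrinking [tau] keeps [lam1] bounded. *)

Module Group_lemmas.
Import ssreflect.

Lemma minus_plus_l {G : AbelianGroup} (x y z : G) :
  minus (plus x y) (plus x z) = minus y z.
Proof.
unfold minus. rewrite opp_plus (plus_comm x y) -plus_assoc.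
by rewrite (plus_assoc x) plus_opp_r plus_zero_l.
Qed.

Lemma minus_plus_cancel {G : AbelianGroup} (x y : G) : minus (plus x y) x = y.
Proof.
unfold minus. by rewrite (plus_comm x y) -plus_assoc plus_opp_r plus_zero_r.
Qed.

Lemma minus_eq_0 {G : AbelianGroup} (x y : G) : minus x y = zero -> x = y.
Proof.
intros E. rewrite -(plus_zero_l y) -E.
unfold minus. by rewrite -plus_assoc plus_opp_l plus_zero_r.
Qed.

Definition vdist {V : NormedModule R_AbsRing} (x y : V) : R := norm (minus x y).

Lemma vdist_sym {V : NormedModule R_AbsRing} (x y : V) : vdist x y = vdist y x.
Proof. by rewrite /vdist -(norm_opp (minus x y)) opp_minus. Qed.

Lemma vdist_triangle {V : NormedModule R_AbsRing} (y x z : V) :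
  vdist x z <= vdist x y + vdist y z.
Proof. rewrite /vdist (minus_trans y x z). apply (norm_triangle (minus x y)). Qed.

Lemma vdist_refl {V : NormedModule R_AbsRing} (x : V) : vdist x x = 0.
Proof. by rewrite /vdist minus_eq_zero norm_zero. Qed.

Lemma vdist_eq_0 {V : NormedModule R_AbsRing} (x y : V) : vdist x y = 0 -> x = y.
Proof. intros E. apply minus_eq_0. by apply norm_eq_zero. Qed.

Lemma vdist_plus_l {V : NormedModule R_AbsRing} (x y z : V) :
  vdist (plus x y) (plus x z) = vdist y z.
Proof. by rewrite /vdist minus_plus_l. Qed.

Lemma vdist_plus_cancel {V : NormedModule R_AbsRing} (x y : V) :
  vdist (plus x y) x = norm y.
Proof. by rewrite /vdist minus_plus_cancel. Qed.

End Group_lemmas.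
Import Group_lemmas.

Section Picard.
Context {V : CompleteNormedModule R_AbsRing}.

Lemma continuous_norm_intro (f : R -> V) (t : R) :
  (forall eps, 0 < eps -> exists delta, 0 < delta /\
     forall s, Rabs (s - t) < delta -> vdist (f s) (f t) < eps) ->
  continuous f t.
Proof.
intros H.
apply (filterlim_locally_ball_norm f).
intros eps.
destruct (H eps (cond_pos eps)) as (d & Hd & Hs).
exists (mkposreal d Hd). intros s Bs. apply Hs. exact Bs.
Qed.

Lemma continuous_norm_elim (f : R -> V) (t : R) :
  continuous f t ->
  forall eps, 0 < eps -> exists delta, 0 < delta /\
     forall s, Rabs (s - t) < delta -> vdist (f s) (f t) < eps.
Proof.
intros H eps He.
destruct (proj1 (filterlim_locally_ball_norm f (f t)) H (mkposreal eps He)) as (d & Hd).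
exists d. split. apply cond_pos. intros s Bs. apply Hd. exact Bs.
Qed.

(** Bounding through a primitive covers both orders of the endpoints; solutions are needed on both
    sides of the initial time. *)
Lemma norm_RInt_le_primitive (f : R -> V) (g G : R -> R) (a b : R) :
  (forall s, continuous f s) -> (forall s, continuous g s) ->
  (forall s, is_derive G s (g s)) ->
  (forall s, Rmin a b <= s <= Rmax a b -> norm (f s) <= g s) ->
  norm (RInt f a b) <= Rabs (G b - G a).
Proof.
intros Cf Cg HG Hle.
assert (K : forall a b, a <= b -> (forall s, a <= s <= b -> norm (f s) <= g s) ->
   norm (RInt f a b) <= Rabs (G b - G a)).
{ clear a b Hle. intros a b ab Hle.
  eapply Rle_trans; [|apply Rle_abs].
  apply (norm_RInt_le f g a b); auto.
  apply RInt_correct, ex_RInt_continuous; auto.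
  change (G b - G a) with (minus (G b) (G a)).
  apply (is_RInt_derive G g); auto. }
destruct (Rle_dec a b) as [ab|ab].
- apply K; auto. intros s Hs. apply Hle.
  rewrite Rmin_left, Rmax_right; auto.
- assert (ba : b <= a) by lra.
  rewrite <- opp_RInt_swap.
  2: apply ex_RInt_continuous; auto.
  rewrite Rabs_minus_sym.
  eapply Rle_trans; [right; apply (norm_opp (RInt f b a))|]. apply K; auto.
  intros s Hs. apply Hle. rewrite Rmin_right, Rmax_left; auto.
Qed.

Context (F : R -> V -> V) (L B : R).
Context (L_pos : 0 < L).
Context (F_lip : forall s x y, vdist (F s x) (F s y) <= L * vdist x y).
Context (F_bounded : forall s x, norm (F s x) <= B).
Context (F_cont : forall x s, continuous (fun s => F s x) s).
Context (s0 : R) (x0 : V).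

Lemma continuous_along (x : R -> V) (s : R) :
  continuous x s -> continuous (fun s => F s (x s)) s.
Proof.
intros Cx. apply continuous_norm_intro. intros eps He.
destruct (continuous_norm_elim _ _ Cx (eps / (2 * L))) as (d1 & Hd1 & H1).
{ apply Rdiv_lt_0_compat; lra. }
destruct (continuous_norm_elim _ _ (F_cont (x s) s) (eps / 2)) as (d2 & Hd2 & H2).
{ lra. }
exists (Rmin d1 d2). split. apply Rmin_pos; auto.
intros r Hr.
specialize (H1 r (Rlt_le_trans _ _ _ Hr (Rmin_l _ _))).
specialize (H2 r (Rlt_le_trans _ _ _ Hr (Rmin_r _ _))).
eapply Rle_lt_trans; [apply (vdist_triangle (F r (x s)))|].
assert (L * vdist (x r) (x s) < eps / 2).
{ apply Rmult_lt_reg_l with (/ L). now apply Rinv_0_lt_compat.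
  replace (/ L * (eps / 2)) with (eps / (2 * L)) by (field; lra).
  rewrite <- Rmult_assoc, Rinv_l, Rmult_1_l; lra. }
generalize (F_lip r (x r) (x s)). lra.
Qed.

Definition picard_step (x : R -> V) (t : R) : V :=
  plus x0 (RInt (fun s => F s (x s)) s0 t).

Fixpoint picard_iter (n : nat) : R -> V :=
  match n with
  | O => fun _ => x0
  | S n => picard_step (picard_iter n)
  end.

(** This bound survives pointwise limits, so the limit of the iterates is continuous without a
    separate argument on uniform convergence. *)
Definition lipschitz_path (x : R -> V) : Prop :=
  forall s t, vdist (x s) (x t) <= B * Rabs (s - t).

Lemma bound_nonneg : 0 <= B.
Proof. eapply Rle_trans; [apply (norm_ge_0 (F s0 x0))|apply F_bounded]. Qed.

Lemma lipschitz_path_continuous (x : R -> V) (t : R) :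
  lipschitz_path x -> continuous x t.
Proof.
intros Hx. apply continuous_norm_intro. intros eps He.
generalize bound_nonneg; intros HB.
exists (eps / (B + 1)). split. apply Rdiv_lt_0_compat; lra.
intros s Hs. eapply Rle_lt_trans; [apply Hx|].
apply Rlt_le_trans with ((B + 1) * (eps / (B + 1))).
2: right; field; lra.
apply Rle_lt_trans with (B * (eps / (B + 1))).
apply Rmult_le_compat_l; lra.
apply Rmult_lt_compat_r; [apply Rdiv_lt_0_compat|]; lra.
Qed.

Lemma picard_step_lipschitz (x : R -> V) :
  lipschitz_path x -> lipschitz_path (picard_step x).
Proof.
intros Hx s t.
assert (C : forall r, continuous (fun s => F s (x s)) r).
{ intros r. now apply continuous_along, lipschitz_path_continuous. }
unfold picard_step. eapply Rle_trans; [right; apply (vdist_plus_l (V := V))|].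
rewrite <- (RInt_Chasles (fun s1 => F s1 (x s1)) s0 t s);
  try (apply ex_RInt_continuous; auto).
eapply Rle_trans; [right; apply (vdist_plus_cancel (V := V))|].
eapply Rle_trans.
apply (norm_RInt_le_primitive _ (fun _ => B) (fun r => B * r)); auto.
intros r; apply continuous_const.
intros r; auto_derive; auto; ring.
rewrite <- Rmult_minus_distr_l, Rabs_mult, (Rabs_pos_eq B).
apply Rle_refl. apply bound_nonneg.
Qed.

Lemma picard_iter_lipschitz (n : nat) : lipschitz_path (picard_iter n).
Proof.
induction n as [|n IH]; [|now apply picard_step_lipschitz].
intros s t; simpl. rewrite vdist_refl.
apply Rmult_le_pos; [apply bound_nonneg|apply Rabs_pos].
Qed.

(** Bielecki's weight: in the sup norm weighted by it the Picard step contracts by 1/2 on the whole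
    line, so no short time intervals have to be glued. *)
Definition weight (t : R) : R := exp (2 * L * Rabs (t - s0)).

Lemma weight_pos (t : R) : 0 < weight t.
Proof. apply exp_pos. Qed.

Lemma picard_step_contracts (x y : R -> V) (c : R) :
  0 <= c -> lipschitz_path x -> lipschitz_path y ->
  (forall s, vdist (x s) (y s) <= c * weight s) ->
  forall t, vdist (picard_step x t) (picard_step y t) <= c / 2 * weight t.
Proof.
intros Hc Hx Hy Hxy t.
assert (Cx : forall r, continuous (fun s => F s (x s)) r).
{ intros r. now apply continuous_along, lipschitz_path_continuous. }
assert (Cy : forall r, continuous (fun s => F s (y s)) r).
{ intros r. now apply continuous_along, lipschitz_path_continuous. }
unfold picard_step. eapply Rle_trans; [right; apply (vdist_plus_l (V := V))|].
replace (vdist (RInt (fun s => F s (x s)) s0 t) (RInt (fun s => F s (y s)) s0 t))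
  with (norm (RInt (fun s => minus (F s (x s)) (F s (y s))) s0 t)).
2: { unfold vdist; f_equal. apply (RInt_minus (V := V)); apply ex_RInt_continuous; auto. }
assert (Cm : forall r, continuous (fun s => minus (F s (x s)) (F s (y s))) r).
{ intros r. now apply (continuous_minus (V := V)). }
assert (Hint : forall s, vdist (F s (x s)) (F s (y s)) <= c * L * weight s).
{ intros s. eapply Rle_trans; [apply F_lip|].
  replace (c * L * weight s) with (L * (c * weight s)) by ring.
  apply Rmult_le_compat_l; auto; lra. }
assert (W : forall G, Rabs G = c / 2 * Rabs (weight t - 1) ->
   Rabs G <= c / 2 * weight t).
{ intros G ->. apply Rmult_le_compat_l; [lra|].
  assert (1 <= weight t).
  { unfold weight. rewrite <- exp_0.
    destruct (Req_dec (2 * L * Rabs (t - s0)) 0) as [->|Hn]; [lra|].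
    left; apply exp_increasing.
    assert (0 <= 2 * L * Rabs (t - s0)) by
      (apply Rmult_le_pos; [lra|apply Rabs_pos]). lra. }
  rewrite Rabs_pos_eq; lra. }
destruct (Rle_dec s0 t) as [st|st].
- eapply Rle_trans.
  apply (norm_RInt_le_primitive _ (fun s => c * L * exp (2 * L * (s - s0)))
     (fun s => c / 2 * exp (2 * L * (s - s0)))); auto.
  + intros s. apply (ex_derive_continuous (K := R_AbsRing) (V := R_NormedModule)). auto_derive; auto.
  + intros s. auto_derive; auto. unfold Rminus; field.
  + intros s Hs. rewrite Rmin_left in Hs; auto.
    eapply Rle_trans; [apply Hint|]. unfold weight.
    rewrite Rabs_pos_eq; lra.
  + apply W. replace (s0 - s0) with 0 by ring. rewrite Rmult_0_r, exp_0.
    rewrite <- Rmult_minus_distr_l, Rabs_mult, (Rabs_pos_eq (c / 2)) by lra.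
    unfold weight. now rewrite (Rabs_pos_eq (t - s0)) by lra.
- eapply Rle_trans.
  apply (norm_RInt_le_primitive _ (fun s => c * L * exp (2 * L * (s0 - s)))
     (fun s => - (c / 2 * exp (2 * L * (s0 - s))))); auto.
  + intros s. apply (ex_derive_continuous (K := R_AbsRing) (V := R_NormedModule)). auto_derive; auto.
  + intros s. auto_derive; auto. unfold Rminus; field.
  + intros s Hs. rewrite Rmax_left in Hs by lra.
    eapply Rle_trans; [apply Hint|]. unfold weight.
    rewrite Rabs_minus_sym, Rabs_pos_eq; lra.
  + apply W. replace (s0 - s0) with 0 by ring. rewrite Rmult_0_r, exp_0.
    replace (- (c / 2 * exp (2 * L * (s0 - t))) - - (c / 2 * 1)) with
      (- (c / 2 * (exp (2 * L * (s0 - t)) - 1))) by ring.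
    rewrite Rabs_Ropp, Rabs_mult, (Rabs_pos_eq (c / 2)) by lra.
    unfold weight. now rewrite (Rabs_minus_sym t s0), (Rabs_pos_eq (s0 - t)) by lra.
Qed.

(** The start of the induction is [B |t - s0| <= B / L * weight t], from [1 + x <= exp x]; each
    further step halves the bound. *)
Lemma picard_iter_step (n : nat) (t : R) :
  vdist (picard_iter (S n) t) (picard_iter n t) <= B / L * (1 / 2) ^ n * weight t.
Proof.
revert t; induction n as [|n IH]; intros t.
- simpl. unfold picard_step. eapply Rle_trans; [right; apply (vdist_plus_cancel (V := V))|]. rewrite Rmult_1_r.
  eapply Rle_trans.
  apply (norm_RInt_le_primitive _ (fun _ => B) (fun s => B * s)); auto.
  intros r; apply continuous_const.
  intros r; auto_derive; auto; ring.
  rewrite <- Rmult_minus_distr_l, Rabs_mult, (Rabs_pos_eq B) by apply bound_nonneg.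
  unfold Rdiv. rewrite Rmult_assoc.
  apply Rmult_le_compat_l; [apply bound_nonneg|].
  apply Rmult_le_reg_l with L; auto.
  rewrite <- Rmult_assoc, Rinv_r, Rmult_1_l by lra.
  unfold weight. generalize (exp_ineq1_le (2 * L * Rabs (t - s0))).
  assert (0 <= L * Rabs (t - s0)) by (apply Rmult_le_pos; [lra|apply Rabs_pos]).
  lra.
- change (picard_iter (S (S n))) with (picard_step (picard_iter (S n))).
  change (picard_iter (S n) t) with (picard_step (picard_iter n) t).
  replace (B / L * (1 / 2) ^ S n) with (B / L * (1 / 2) ^ n / 2) by (simpl; lra).
  apply picard_step_contracts; auto using picard_iter_lipschitz.
  apply Rmult_le_pos.
  apply Rdiv_le_0_compat; auto using bound_nonneg.
  apply pow_le; lra.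
Qed.

(** Keeping the exact geometric sum, with its factor [1 - (1 / 2) ^ m], lets the induction on [m]
    close. *)
Lemma picard_iter_cauchy (n m : nat) (t : R) :
  vdist (picard_iter (n + m) t) (picard_iter n t)
    <= B / L * weight t * 2 * (1 / 2) ^ n * (1 - (1 / 2) ^ m).
Proof.
induction m as [|m IH].
- rewrite Nat.add_0_r, vdist_refl. simpl; lra.
- rewrite Nat.add_succ_r.
  eapply Rle_trans; [apply (vdist_triangle (picard_iter (n + m) t))|].
  generalize (picard_iter_step (n + m) t). rewrite pow_add.
  simpl pow. lra.
Qed.

Lemma geometric_small (c eps : R) :
  0 < eps -> exists N, forall n, (N <= n)%nat -> c * (1 / 2) ^ n < eps.
Proof.
intros He.
destruct (pow_lt_1_zero (1 / 2)) with (y := eps / (Rabs c + 1)) as (N & HN).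
rewrite Rabs_pos_eq; lra.
apply Rdiv_lt_0_compat; auto. generalize (Rabs_pos c); lra.
exists N. intros n Hn. specialize (HN n Hn).
rewrite Rabs_pos_eq in HN by (apply pow_le; lra).
generalize (Rabs_pos c) (Rle_abs c) (pow_le (1/2) n); intros A1 A2 A3.
apply Rle_lt_trans with ((Rabs c + 1) * (1 / 2) ^ n).
apply Rmult_le_compat_r; [apply A3; lra | lra].
apply Rlt_le_trans with ((Rabs c + 1) * (eps / (Rabs c + 1))).
apply Rmult_lt_compat_l; lra.
right; field; lra.
Qed.

Lemma picard_limit_at (t : R) :
  exists y : V, forall n,
    vdist y (picard_iter n t) <= B / L * weight t * 2 * (1 / 2) ^ n.
Proof.
set (c := B / L * weight t * 2).
assert (Hc : 0 <= c).
{ unfold c. apply Rmult_le_pos; [|lra]. apply Rmult_le_pos.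
  apply Rdiv_le_0_compat; auto using bound_nonneg.
  left; apply weight_pos. }
assert (Hnm : forall n m, (n <= m)%nat ->
   vdist (picard_iter m t) (picard_iter n t) <= c * (1 / 2) ^ n).
{ intros n m nm. replace m with (n + (m - n))%nat by lia.
  eapply Rle_trans; [apply picard_iter_cauchy|]. fold c.
  rewrite <- (Rmult_1_r (c * (1 / 2) ^ n)) at 2.
  apply Rmult_le_compat_l.
  apply Rmult_le_pos; auto. apply pow_le; lra.
  generalize (pow_le (1 / 2) (m - n)); lra. }
destruct (proj1 (filterlim_locally_cauchy (F := eventually)
   (fun n => picard_iter n t))) as (y & Hy).
{ intros eps. destruct (geometric_small c eps (cond_pos eps)) as (N & HN).
  exists (fun n => (N <= n)%nat). split. now exists N.
  intros u v Hu Hv. apply (norm_compat1 (V := V)). fold (vdist (picard_iter v t) (picard_iter u t)).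
  destruct (Nat.le_ge_cases u v) as [uv|uv].
  eapply Rle_lt_trans; [now apply Hnm|now apply HN].
  rewrite vdist_sym.
  eapply Rle_lt_trans; [now apply Hnm|now apply HN]. }
exists y. intros n. apply le_epsilon. intros eps He.
destruct (proj1 (filterlim_locally_ball_norm _ _) Hy (mkposreal eps He)) as (N & HN).
specialize (HN (n + N)%nat ltac:(lia)).
eapply Rle_trans; [apply (vdist_triangle (picard_iter (n + N) t))|].
rewrite vdist_sym. change (vdist (picard_iter (n + N) t) y < eps) in HN.
generalize (Hnm n (n + N)%nat ltac:(lia)). lra.
Qed.

(** A bounded and globally Lipschitz field has solutions for all times, forward and backward; the
    cut Loewner field is made to meet these hypotheses. *)
Theorem picard_lindelof :
  exists x : R -> V, x s0 = x0 /\ forall t, is_derive x t (F t (x t)).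
Proof.
set (x := fun t => proj1_sig (constructive_indefinite_description _ (picard_limit_at t))).
assert (Hx : forall t n, vdist (x t) (picard_iter n t)
   <= B / L * weight t * 2 * (1 / 2) ^ n).
{ intros t. unfold x. now destruct constructive_indefinite_description. }
assert (Lx : lipschitz_path x).
{ intros s t. apply le_epsilon. intros eps He.
  destruct (geometric_small (B / L * weight s * 2) (eps / 2)) as (N & HN); [lra|].
  destruct (geometric_small (B / L * weight t * 2) (eps / 2)) as (N' & HN'); [lra|].
  specialize (HN (N + N')%nat ltac:(lia)). specialize (HN' (N + N')%nat ltac:(lia)).
  generalize (Hx s (N + N')%nat) (Hx t (N + N')%nat)
    (picard_iter_lipschitz (N + N') s t)
    (vdist_triangle (picard_iter (N + N') s) (x s) (x t))
    (vdist_triangle (picard_iter (N + N') t) (picard_iter (N + N') s) (x t)).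
  rewrite (vdist_sym (picard_iter (N + N') t) (x t)). lra. }
assert (Cx : forall r, continuous (fun s => F s (x s)) r).
{ intros r. now apply continuous_along, lipschitz_path_continuous. }
(* Both [x t] and [picard_step x t] are within a multiple of [(1 / 2) ^ N] of the iterate [S N], the
   latter by contraction, and [N] is arbitrary. *)
assert (Fix : forall t, x t = picard_step x t).
{ intros t.
  assert (E : vdist (x t) (picard_step x t) = 0).
  { apply Rle_antisym; [|apply norm_ge_0].
    apply le_epsilon. intros eps He. rewrite Rplus_0_l.
    destruct (geometric_small (B / L * weight t * 2) eps) as (N & HN); [lra|].
    specialize (HN N (Nat.le_refl N)).
    generalize (vdist_triangle (picard_iter (S N) t) (x t) (picard_step x t))
      (Hx t (S N)).
    assert (Hc : 0 <= B / L * 2 * (1 / 2) ^ N).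
    { apply Rmult_le_pos; [apply Rmult_le_pos; [|lra]|apply pow_le; lra].
      apply Rdiv_le_0_compat; auto using bound_nonneg. }
    assert (Hxn : forall s, vdist (x s) (picard_iter N s) <=
       B / L * 2 * (1 / 2) ^ N * weight s).
    { intros s. generalize (Hx s N). lra. }
    generalize (picard_step_contracts x (picard_iter N) _ Hc Lx
       (picard_iter_lipschitz N) Hxn t).
    rewrite (vdist_sym (picard_iter (S N) t)).
    simpl picard_iter. simpl pow. lra. }
  now apply vdist_eq_0. }
exists x. split.
- rewrite Fix. unfold picard_step. now rewrite RInt_point, plus_zero_r.
- intros t. apply (is_derive_ext (picard_step x)).
  { intros s. now rewrite <- Fix. }
  rewrite <- (plus_zero_l (F t (x t))).
  apply (is_derive_plus (fun _ => x0)).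
  apply (is_derive_const x0).
  apply (is_derive_RInt (fun s => F s (x s)) _ s0); auto.
  exists (mkposreal 1 Rlt_0_1). intros s _.
  apply RInt_correct, ex_RInt_continuous; auto.
Qed.

End Picard.

(** * Complex-valued functions of a real variable *)

(** Working by coordinates gives access to the real mean value theorem and to monotonicity
    arguments. *)
Definition cderiv (f : R -> C) (s : R) (d : C) : Prop :=
  is_derive (fun r => Re (f r)) s (Re d) /\ is_derive (fun r => Im (f r)) s (Im d).

Lemma is_derive_cderiv (f : R -> C) (s : R) (d : C) :
  @is_derive R_AbsRing C_R_NormedModule f s d -> cderiv f s d.
Proof.
intros H. split.
- exact (filterdiff_comp' (K := R_AbsRing) (U := R_NormedModule) (V := C_R_NormedModule)
    (W := R_NormedModule) f (fun z => fst z) s (fun y => scal y d) (fun z => fst z) H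
    (filterdiff_linear _ (is_linear_fst (U := R_NormedModule) (V := R_NormedModule)))).
- exact (filterdiff_comp' (K := R_AbsRing) (U := R_NormedModule) (V := C_R_NormedModule)
    (W := R_NormedModule) f (fun z => snd z) s (fun y => scal y d) (fun z => snd z) H
    (filterdiff_linear _ (is_linear_snd (U := R_NormedModule) (V := R_NormedModule)))).
Qed.

Lemma Cmod_le_Re_Im (z : C) : Cmod z <= Rabs (Re z) + Rabs (Im z).
Proof.
generalize (Cmod_ge_0 z) (Rabs_pos (Re z)) (Rabs_pos (Im z)); intros.
apply Rsqr_incr_0_var; [|lra]. rewrite !Rsqr_pow2, Cmod2_alt.
rewrite <- (pow2_abs (Re z)), <- (pow2_abs (Im z)). nra.
Qed.

Lemma Im_le_Cmod (z : C) : Rabs (Im z) <= Cmod z.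
Proof.
apply Rsqr_incr_0_var; [|apply Cmod_ge_0].
rewrite !Rsqr_pow2, Cmod2_alt, pow2_abs. nra.
Qed.

(** Stated over any absolute ring, since it serves both derivatives in real time and complex
    derivatives in the initial point. *)
Lemma is_derive_C_intro (K : AbsRing) (V : NormedModule K) (f : K -> V) (s : K) (d : V) :
  (forall eps, 0 < eps -> locally s (fun r =>
     norm (minus (minus (f r) (f s)) (scal (minus r s) d)) <= eps * norm (minus r s))) ->
  is_derive f s d.
Proof.
intros H. split. apply is_linear_scal_l.
intros x Hx. apply (is_filter_lim_locally_unique (V := AbsRing_NormedModule K)) in Hx. subst x.
intros eps. exact (H eps (cond_pos eps)).
Qed.

Lemma is_derive_R_elim (f : R -> R) (s d : R) :
  is_derive f s d -> forall eps, 0 < eps -> locally s (fun r =>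
     Rabs (f r - f s - (r - s) * d) <= eps * Rabs (r - s)).
Proof.
intros [_ H] eps He.
exact (H s (fun P HP => HP) (mkposreal eps He)).
Qed.

Lemma cderiv_is_derive (f : R -> C) (s : R) (d : C) :
  cderiv f s d -> @is_derive R_AbsRing C_R_NormedModule f s d.
Proof.
intros [H1 H2]. apply is_derive_C_intro. intros eps He.
assert (He2 : 0 < eps / 2) by lra.
generalize (filter_and _ _ (is_derive_R_elim _ _ _ H1 _ He2)
  (is_derive_R_elim _ _ _ H2 _ He2)).
apply filter_imp. intros r [A1 A2].
rewrite <- Cmod_norm. eapply Rle_trans; [apply Cmod_le_Re_Im|].
change (norm (minus r s)) with (Rabs (r - s)).
replace (eps * Rabs (r - s)) with (eps / 2 * Rabs (r - s) + eps / 2 * Rabs (r - s)) by field.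
apply Rplus_le_compat; [exact A1|exact A2].
Qed.

Lemma cderiv_plus f g s df dg :
  cderiv f s df -> cderiv g s dg -> cderiv (fun r => f r + g r)%C s (df + dg)%C.
Proof.
intros [] []. split; simpl.
now apply (is_derive_plus (fun r => Re (f r)) (fun r => Re (g r))).
now apply (is_derive_plus (fun r => Im (f r)) (fun r => Im (g r))).
Qed.

Lemma cderiv_minus f g s df dg :
  cderiv f s df -> cderiv g s dg -> cderiv (fun r => f r - g r)%C s (df - dg)%C.
Proof.
intros [] []. split; simpl.
now apply (is_derive_minus (fun r => Re (f r)) (fun r => Re (g r))).
now apply (is_derive_minus (fun r => Im (f r)) (fun r => Im (g r))).
Qed.

Lemma is_derive_eq (f : R -> R) (s d d' : R) : is_derive f s d -> d = d' -> is_derive f s d'.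
Proof. now intros H <-. Qed.

Lemma cderiv_mult f g s df dg :
  cderiv f s df -> cderiv g s dg ->
  cderiv (fun r => f r * g r)%C s (df * g s + f s * dg)%C.
Proof.
intros [F1 F2] [G1 G2]. split; simpl.
- eapply is_derive_eq. apply (is_derive_minus (fun r => Re (f r) * Re (g r))
    (fun r => Im (f r) * Im (g r)));
  apply (is_derive_mult (K := R_AbsRing)); eauto using Rmult_comm.
  unfold minus, plus, opp, mult; simpl. unfold Re, Im. ring.
- eapply is_derive_eq. apply (is_derive_plus (fun r => Re (f r) * Im (g r))
    (fun r => Im (f r) * Re (g r)));
  apply (is_derive_mult (K := R_AbsRing)); eauto using Rmult_comm.
  unfold minus, plus, opp, mult; simpl. unfold Re, Im. ring.
Qed.

Lemma cderiv_RtoC f s d : is_derive f s d -> cderiv (fun r => RtoC (f r)) s (RtoC d).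
Proof. intros H. split; simpl; auto. apply (is_derive_const 0). Qed.

Lemma cderiv_const (c : C) s : cderiv (fun _ => c) s (RtoC 0).
Proof. split; apply (is_derive_const (V := R_NormedModule)). Qed.

Lemma cderiv_eq f s d d' : cderiv f s d -> d = d' -> cderiv f s d'.
Proof. now intros H <-. Qed.

(** * Monotonicity, Gronwall and mean value estimates *)

Lemma is_derive_continuity (f : R -> R) (s d : R) : is_derive f s d -> continuity_pt f s.
Proof.
intros H. apply derivable_continuous_pt. exists d. now apply is_derive_Reals.
Qed.

Lemma derive_le_0_decr (f df : R -> R) (a b : R) : a <= b ->
  (forall s, a <= s <= b -> is_derive f s (df s)) ->
  (forall s, a <= s <= b -> df s <= 0) -> f b <= f a.
Proof.
intros ab H Hneg.
destruct (MVT_gen f a b df) as (c & Hc & E).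
- rewrite Rmin_left, Rmax_right by lra. intros x Hx; apply H; lra.
- rewrite Rmin_left, Rmax_right by lra. intros x Hx.
  eapply is_derive_continuity. apply H; lra.
- rewrite Rmin_left, Rmax_right in Hc by lra.
  specialize (Hneg c Hc). nra.
Qed.

Lemma derive_ge_0_incr (f df : R -> R) (a b : R) : a <= b ->
  (forall s, a <= s <= b -> is_derive f s (df s)) ->
  (forall s, a <= s <= b -> 0 <= df s) -> f a <= f b.
Proof.
intros ab H Hpos.
apply Ropp_le_cancel.
apply (derive_le_0_decr (fun s => - f s) (fun s => - df s)); auto.
- intros s Hs. now apply (is_derive_opp f), H.
- intros s Hs. specialize (Hpos s Hs). lra.
Qed.

Lemma cauchy_schwarz_C (z w : C) : Rabs (Re z * Re w + Im z * Im w) <= Cmod z * Cmod w.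
Proof.
rewrite <- (Cmod_conj w), <- Cmod_mult.
eapply Rle_trans; [|apply re_le_Cmod].
right; f_equal. destruct z, w; simpl. ring.
Qed.

Lemma is_derive_Cmod2 f s d : cderiv f s d ->
  is_derive (fun r => Cmod (f r) ^ 2) s (2 * (Re (f s) * Re d + Im (f s) * Im d)).
Proof.
intros [H1 H2].
apply (is_derive_ext (fun r => Re (f r) * Re (f r) + Im (f r) * Im (f r))).
{ intros r. rewrite Cmod2_alt. simpl. ring. }
eapply is_derive_eq.
apply (is_derive_plus (fun r => Re (f r) * Re (f r)) (fun r => Im (f r) * Im (f r)));
  apply (is_derive_mult (K := R_AbsRing)); eauto using Rmult_comm.
unfold plus, mult; simpl. ring.
Qed.

Lemma sq_le_exp (x y e : R) : 0 <= y ->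
  x ^ 2 * exp (- (2 * e)) <= y ^ 2 -> x <= y * exp e.
Proof.
intros Hy H.
assert (Ee : exp (- (2 * e)) * (exp e * exp e) = 1).
{ rewrite <- !exp_plus, <- exp_0. f_equal; ring. }
assert (P := exp_pos e).
apply Rsqr_incr_0_var; [|now apply Rmult_le_pos; [|left]].
unfold Rsqr.
replace (x * x) with (x ^ 2 * exp (- (2 * e)) * (exp e * exp e)).
2: { rewrite Rmult_assoc, Ee; ring. }
replace (y * exp e * (y * exp e)) with (y ^ 2 * (exp e * exp e)) by ring.
apply Rmult_le_compat_r; auto. apply Rmult_le_pos; lra.
Qed.

(** The squared modulus is differentiable even where [f] vanishes. The integrating factors
    [exp (-2 phi)] and [exp (2 phi)] make it decreasing and increasing respectively, which gives the
    forward and the backward bound. *)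
Lemma gronwall_C (f f' : R -> C) (k phi : R -> R) (a b : R) : a <= b ->
  (forall s, a <= s <= b -> cderiv f s (f' s)) ->
  (forall s, a <= s <= b -> is_derive phi s (k s)) ->
  (forall s, a <= s <= b -> Cmod (f' s) <= k s * Cmod (f s)) ->
  Cmod (f b) <= Cmod (f a) * exp (phi b - phi a) /\
  Cmod (f a) <= Cmod (f b) * exp (phi b - phi a).
Proof.
intros ab Hf Hphi Hk.
set (p s := 2 * (Re (f s) * Re (f' s) + Im (f s) * Im (f' s))).
assert (Hp : forall s, a <= s <= b -> Rabs (p s) <= 2 * k s * Cmod (f s) ^ 2).
{ intros s Hs. unfold p. rewrite Rabs_mult, (Rabs_pos_eq 2) by lra.
  generalize (cauchy_schwarz_C (f s) (f' s)) (Hk s Hs) (Cmod_ge_0 (f s)). intros. nra. }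
assert (Hd : forall c s, a <= s <= b -> is_derive (fun r => Cmod (f r) ^ 2 * exp (c * phi r)) s
   ((p s + c * k s * Cmod (f s) ^ 2) * exp (c * phi s))).
{ intros c s Hs. eapply is_derive_eq.
  apply (is_derive_mult (K := R_AbsRing) (fun r => Cmod (f r) ^ 2) (fun r => exp (c * phi r)));
   [now apply is_derive_Cmod2, Hf| |exact Rmult_comm].
  apply (is_derive_comp (V := R_NormedModule) exp (fun r => c * phi r)).
  apply is_derive_exp.
  apply (is_derive_scal phi). now apply Hphi.
  unfold plus, mult, scal, p; simpl. unfold mult; simpl. ring. }
assert (Ee : forall u v, exp (u * phi v) > 0) by (intros; apply exp_pos).
split; apply sq_le_exp; try apply Cmod_ge_0.
- assert (D : Cmod (f b) ^ 2 * exp (-2 * phi b) <= Cmod (f a) ^ 2 * exp (-2 * phi a)).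
  { apply (derive_le_0_decr (fun r => Cmod (f r) ^ 2 * exp (-2 * phi r)) _ a b ab (Hd (-2))).
    intros s Hs. generalize (Hp s Hs) (Rle_abs (p s)) (Ee (-2) s). intros. nra. }
  replace (- (2 * (phi b - phi a))) with (-2 * phi b + - (-2 * phi a)) by ring.
  rewrite exp_plus, <- Rmult_assoc, exp_Ropp.
  apply Rmult_le_reg_r with (exp (-2 * phi a)); [apply Ee|].
  rewrite Rmult_assoc, Rinv_l, Rmult_1_r; auto. apply Rgt_not_eq, Ee.
- assert (D : Cmod (f a) ^ 2 * exp (2 * phi a) <= Cmod (f b) ^ 2 * exp (2 * phi b)).
  { apply (derive_ge_0_incr (fun r => Cmod (f r) ^ 2 * exp (2 * phi r)) _ a b ab (Hd 2)).
    intros s Hs. generalize (Hp s Hs) (Rle_abs (- p s)) (Ee 2 s). rewrite Rabs_Ropp. intros. nra. }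
  replace (- (2 * (phi b - phi a))) with (2 * phi a + - (2 * phi b)) by ring.
  rewrite exp_plus, <- Rmult_assoc, exp_Ropp.
  apply Rmult_le_reg_r with (exp (2 * phi b)); [apply Ee|].
  rewrite Rmult_assoc, Rinv_l, Rmult_1_r; auto. apply Rgt_not_eq, Ee.
Qed.

Lemma mean_value_R (f df : R -> R) (k a b : R) : a <= b ->
  (forall s, a <= s <= b -> is_derive f s (df s)) ->
  (forall s, a <= s <= b -> Rabs (df s) <= k) ->
  Rabs (f b - f a) <= k * (b - a).
Proof.
intros ab H Hk.
destruct (MVT_gen f a b df) as (c & Hc & E).
- rewrite Rmin_left, Rmax_right by lra. intros x Hx; apply H; lra.
- rewrite Rmin_left, Rmax_right by lra. intros x Hx.
  eapply is_derive_continuity. apply H; lra.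
- rewrite Rmin_left, Rmax_right in Hc by lra.
  rewrite E, Rabs_mult, (Rabs_pos_eq (b - a)) by lra.
  apply Rmult_le_compat_r; auto; lra.
Qed.

(** The factor 2 is the cost of applying the real mean value theorem to the two coordinates
    separately. *)
Lemma mean_value_C (f f' : R -> C) (k a b : R) : a <= b ->
  (forall s, a <= s <= b -> cderiv f s (f' s)) ->
  (forall s, a <= s <= b -> Cmod (f' s) <= k) ->
  Cmod (f b - f a)%C <= 2 * k * (b - a).
Proof.
intros ab H Hk.
eapply Rle_trans; [apply Cmod_le_Re_Im|].
assert (Rabs (Re (f b) - Re (f a)) <= k * (b - a)).
{ apply (mean_value_R (fun s => Re (f s)) (fun s => Re (f' s))); auto.
  apply H. intros s Hs. eapply Rle_trans; [apply re_le_Cmod|auto]. }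
assert (Rabs (Im (f b) - Im (f a)) <= k * (b - a)).
{ apply (mean_value_R (fun s => Im (f s)) (fun s => Im (f' s))); auto.
  apply H. intros s Hs. eapply Rle_trans; [apply Im_le_Cmod|auto]. }
destruct (f a), (f b); simpl in *. unfold Rminus in *. lra.
Qed.

(** * Trajectories of the Loewner equation *)

Lemma C_neq_0_Im (z : C) : 0 < Im z -> z <> RtoC 0.
Proof. intros H ->. simpl in H. lra. Qed.

Lemma Cmod_pos_Im (z : C) : 0 < Im z -> 0 < Cmod z.
Proof. intros H. now apply Cmod_gt_0, C_neq_0_Im. Qed.

Lemma inv_diff_C (z w : C) : z <> RtoC 0 -> w <> RtoC 0 ->
  (2 / z - 2 / w = - (2 * (z - w) / (z * w)))%C.
Proof. intros. field. auto. Qed.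

Lemma Cmod_two (z : C) : z <> RtoC 0 -> Cmod (2 / z) = 2 / Cmod z.
Proof. intros. rewrite Cmod_div; auto. now rewrite Cmod_R, Rabs_pos_eq by lra. Qed.

Lemma Im_two_div (z : C) : Im (2 / z)%C = - (2 * Im z / (Re z ^ 2 + Im z ^ 2)).
Proof.
destruct z as [x y]. unfold Cdiv, Cinv, Cmult; simpl. unfold Rdiv. ring.
Qed.

Lemma Re_two_div (z : C) : Re (2 / z)%C = 2 * Re z / (Re z ^ 2 + Im z ^ 2).
Proof.
destruct z as [x y]. unfold Cdiv, Cinv, Cmult; simpl. unfold Rdiv. ring.
Qed.

(* Replacing u by [cut delta u] turns 2 / u into a bounded Lipschitz field on C, unchanged where
   [delta <= Im u]; Im u decreases in time, so only its final value has to be checked. *)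
Definition cut (delta : R) (u : C) : C := (Re u, Rmax (Im u) delta).

Lemma cut_lower (delta : R) (u : C) : 0 < delta -> delta <= Cmod (cut delta u).
Proof.
intros H. eapply Rle_trans; [|apply Im_le_Cmod]. simpl.
eapply Rle_trans; [|apply Rle_abs]. apply Rmax_r.
Qed.

Lemma cut_neq_0 (delta : R) (u : C) : 0 < delta -> cut delta u <> RtoC 0.
Proof.
intros H. apply C_neq_0_Im. simpl. apply Rlt_le_trans with (1 := H), Rmax_r.
Qed.

Lemma cut_lip (delta : R) (u w : C) :
  Cmod (cut delta u - cut delta w)%C <= Cmod (u - w)%C.
Proof.
apply Rsqr_incr_0_var; [|apply Cmod_ge_0].
rewrite !Rsqr_pow2, !Cmod2_alt. destruct u as [a b], w as [c d].
apply Rplus_le_compat_l. rewrite <- !Rsqr_pow2. apply Rsqr_le_abs_1.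
simpl. unfold Rmax, Rabs.
repeat destruct Rle_dec; repeat destruct Rcase_abs; lra.
Qed.

Lemma cut_id (delta : R) (u : C) : delta <= Im u -> cut delta u = u.
Proof. intros H. unfold cut. rewrite Rmax_left; auto. now destruct u. Qed.

Lemma inv_diff_bound (delta : R) (z w : C) : 0 < delta ->
  delta <= Cmod z -> delta <= Cmod w ->
  Cmod (2 / z - 2 / w) <= 2 / delta ^ 2 * Cmod (z - w).
Proof.
intros Hd Hz Hw.
assert (z0 : z <> RtoC 0) by (apply Cmod_gt_0; lra).
assert (w0 : w <> RtoC 0) by (apply Cmod_gt_0; lra).
rewrite inv_diff_C, Cmod_opp, Cmod_div, !Cmod_mult, Cmod_R, Rabs_pos_eq by
  (auto; try lra; now apply Cmult_neq_0).
replace (2 / delta ^ 2 * Cmod (z - w)) with (2 * Cmod (z - w) * / (delta * delta)) by (field; lra).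
apply Rmult_le_compat_l.
generalize (Cmod_ge_0 (z - w)); lra.
apply Rinv_le_contravar; nra.
Qed.

Section Loewner.
Context (lam1 : R -> R) (M : R).
Context (lam1_cont : forall s, continuous lam1 s).
Context (lam1_bound : forall s, Rabs (lam1 s) <= M).
Context (M_pos : 0 < M).

Definition cut_field (delta s : R) (u : C) : C := (2 / cut delta u - lam1 s)%C.

Definition cut_sol (delta : R) (u : R -> C) (s : R) : Prop :=
  cderiv u s (cut_field delta s (u s)).

Definition loewner_sol (u : R -> C) (s : R) : Prop :=
  cderiv u s (2 / u s - lam1 s)%C.

(** The derivatives are two-sided even at the ends 0 and [t]; this fits solutions of the cut
    equation, which live on the whole line. *)
Definition traj (t : R) (u : R -> C) : Prop :=
  forall s, 0 <= s <= t -> 0 < Im (u s) /\ loewner_sol u s.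

Lemma cut_sol_loewner delta u s : delta <= Im (u s) -> cut_sol delta u s -> loewner_sol u s.
Proof. intros H. unfold cut_sol, cut_field. now rewrite cut_id. Qed.

Lemma loewner_cut_sol delta u s : delta <= Im (u s) -> loewner_sol u s -> cut_sol delta u s.
Proof. intros H. unfold cut_sol, cut_field. now rewrite cut_id. Qed.

Lemma cut_field_lip (delta s : R) (u w : C) : 0 < delta ->
  Cmod (cut_field delta s u - cut_field delta s w) <= 2 / delta ^ 2 * Cmod (u - w).
Proof.
intros Hd. unfold cut_field.
replace (2 / cut delta u - lam1 s - (2 / cut delta w - lam1 s))%C
  with (2 / cut delta u - 2 / cut delta w)%C by ring.
eapply Rle_trans; [apply (inv_diff_bound delta); auto using cut_lower|].
apply Rmult_le_compat_l; [|apply cut_lip].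
left. apply Rdiv_lt_0_compat; [lra|]. apply pow_lt; lra.
Qed.

(** The value may be prescribed at any time: [s0 = 0] follows an initial point, [s0 = t] solves
    backward from a wanted end point. *)
Lemma cut_flow (delta s0 : R) (z : C) : 0 < delta ->
  exists u : R -> C, u s0 = z /\ forall s, cut_sol delta u s.
Proof.
intros Hd.
destruct (picard_lindelof (V := C_R_CompleteNormedModule) (cut_field delta)
  (2 / delta ^ 2) (2 / delta + M)) with (s0 := s0) (x0 := z) as (u & Hu & Du).
- apply Rdiv_lt_0_compat; [lra|]. apply pow_lt; lra.
- intros s x y. generalize (cut_field_lip delta s x y Hd). rewrite !Cmod_norm. auto.
- intros s x. rewrite <- Cmod_norm. unfold cut_field, Cminus.
  eapply Rle_trans; [apply Cmod_triangle|].
  rewrite Cmod_opp, Cmod_R, Cmod_two by now apply cut_neq_0.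
  apply Rplus_le_compat; auto.
  apply Rmult_le_compat_l; [lra|]. apply Rinv_le_contravar; auto using cut_lower.
- intros x s. apply (continuous_norm_intro (V := C_R_CompleteNormedModule)).
  intros eps He.
  destruct (continuous_norm_elim (V := R_CompleteNormedModule) _ _ (lam1_cont s) eps He)
    as (d & Hd' & Hs).
  exists d. split; auto. intros r Hr. specialize (Hs r Hr).
  apply Rle_lt_trans with (Cmod (cut_field delta r x - cut_field delta s x)%C).
  right; symmetry; apply Cmod_norm.
  unfold cut_field.
  replace (2 / cut delta x - lam1 r - (2 / cut delta x - lam1 s))%C
    with (RtoC (lam1 s - lam1 r)) by (rewrite RtoC_minus; ring).
  rewrite Cmod_R, Rabs_minus_sym. exact Hs.
- exists u. split; auto. intros s. apply is_derive_cderiv, Du.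
Qed.

Lemma cut_flow_dep (delta a b : R) (u w : R -> C) : 0 < delta -> a <= b ->
  (forall s, a <= s <= b -> cut_sol delta u s) ->
  (forall s, a <= s <= b -> cut_sol delta w s) ->
  Cmod (u b - w b) <= Cmod (u a - w a) * exp (2 / delta ^ 2 * (b - a)) /\
  Cmod (u a - w a) <= Cmod (u b - w b) * exp (2 / delta ^ 2 * (b - a)).
Proof.
intros Hd ab Hu Hw.
replace (2 / delta ^ 2 * (b - a)) with (2 / delta ^ 2 * b - 2 / delta ^ 2 * a) by ring.
apply (gronwall_C (fun s => u s - w s)%C
  (fun s => cut_field delta s (u s) - cut_field delta s (w s))%C (fun _ => 2 / delta ^ 2)
  (fun s => 2 / delta ^ 2 * s)); auto.
- intros s Hs. apply cderiv_minus; [now apply Hu|now apply Hw].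
- intros s Hs. auto_derive; auto. field; lra.
- intros s Hs. now apply cut_field_lip.
Qed.

(** [lam1] is real and [Im (2 / z) < 0] in the half-plane. *)
Lemma cut_sol_Im_decr (delta a b : R) (u : R -> C) : 0 < delta -> a <= b ->
  (forall s, a <= s <= b -> cut_sol delta u s) -> Im (u b) <= Im (u a).
Proof.
intros Hd ab Hu.
apply (derive_le_0_decr (fun s => Im (u s)) (fun s => Im (cut_field delta s (u s)))); auto.
- intros s Hs. apply Hu; auto.
- intros s Hs. unfold cut_field.
  replace (Im (2 / cut delta (u s) - lam1 s)) with (Im (2 / cut delta (u s))) by (simpl; ring).
  rewrite Im_two_div.
  assert (0 < Im (cut delta (u s))).
  { simpl. apply Rlt_le_trans with (1 := Hd), Rmax_r. }
  assert (0 <= 2 * Im (cut delta (u s)) / (Re (cut delta (u s)) ^ 2 + Im (cut delta (u s)) ^ 2)).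
  { apply Rdiv_le_0_compat; nra. }
  lra.
Qed.

(** * Trajectories: decreasing height, uniqueness, extension *)

Lemma traj_restrict (s t : R) (u : R -> C) : s <= t -> traj t u -> traj s u.
Proof. intros st H r Hr. apply H; lra. Qed.

Lemma traj_Im_decr (t r s : R) (u : R -> C) : traj t u -> 0 <= r -> r <= s -> s <= t ->
  Im (u s) <= Im (u r).
Proof.
intros H r0 rs st.
apply (derive_le_0_decr (fun s => Im (u s)) (fun s => Im (2 / u s - lam1 s)%C)); auto.
- intros q Hq. apply H; lra.
- intros q Hq.
  replace (Im (2 / u q - lam1 q)) with (Im (2 / u q)) by (simpl; ring).
  rewrite Im_two_div. destruct (H q) as [Hp _]; [lra|].
  assert (0 <= 2 * Im (u q) / (Re (u q) ^ 2 + Im (u q) ^ 2)).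
  { apply Rdiv_le_0_compat; nra. }
  lra.
Qed.

Lemma traj_cut_sol (t delta : R) (u : R -> C) : traj t u -> delta <= Im (u t) ->
  forall s, 0 <= s <= t -> cut_sol delta u s.
Proof.
intros H Hd s Hs. apply loewner_cut_sol.
eapply Rle_trans; [exact Hd|]. apply (traj_Im_decr t); auto; lra. now apply H.
Qed.

Lemma cut_sol_traj (t delta : R) (u : R -> C) : 0 < delta ->
  (forall s, 0 <= s <= t -> cut_sol delta u s) -> delta <= Im (u t) -> traj t u.
Proof.
intros Hd H Ht s Hs.
assert (delta <= Im (u s)).
{ eapply Rle_trans; [exact Ht|]. apply (cut_sol_Im_decr delta); auto; try lra.
  intros r Hr; apply H; lra. }
split; [lra|]. apply (cut_sol_loewner delta); auto.
Qed.

Lemma Cmod_minus_0 (z w : C) : Cmod (z - w) <= 0 -> z = w.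
Proof.
intros H. assert (E : (z - w)%C = RtoC 0).
{ apply Cmod_eq_0. generalize (Cmod_ge_0 (z - w)); lra. }
replace z with (z - w + w)%C by ring. rewrite E; ring.
Qed.

Lemma traj_unique (t : R) (u w : R -> C) : traj t u -> traj t w -> u 0 = w 0 ->
  forall s, 0 <= s <= t -> u s = w s.
Proof.
intros Hu Hw E s Hs.
assert (H1 := traj_restrict s t u ltac:(lra) Hu).
assert (H2 := traj_restrict s t w ltac:(lra) Hw).
destruct (H1 s) as [P1 _]; [lra|]. destruct (H2 s) as [P2 _]; [lra|].
set (delta := Rmin (Im (u s)) (Im (w s))).
assert (Hd : 0 < delta) by now apply Rmin_pos.
destruct (cut_flow_dep delta 0 s u w) as [D _]; auto; try lra.
- apply (traj_cut_sol s); auto. apply Rmin_l.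
- apply (traj_cut_sol s); auto. apply Rmin_r.
- apply Cmod_minus_0. rewrite E in D.
  replace (w 0 - w 0)%C with (RtoC 0) in D by ring.
  rewrite Cmod_0 in D. lra.
Qed.

(** Backward dependence on the end point; this is the injectivity of the Loewner maps. *)
Lemma traj_unique_end (t : R) (u w : R -> C) : 0 <= t -> traj t u -> traj t w -> u t = w t ->
  u 0 = w 0.
Proof.
intros t0 H1 H2 E.
destruct (H1 t) as [P1 _]; [lra|]. destruct (H2 t) as [P2 _]; [lra|].
destruct (cut_flow_dep (Im (u t)) 0 t u w) as [_ D]; auto; try lra.
- apply (traj_cut_sol t); auto. lra.
- apply (traj_cut_sol t); auto. rewrite E; lra.
- apply Cmod_minus_0. rewrite E in D.
  replace (w t - w t)%C with (RtoC 0) in D by ring.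
  rewrite Cmod_0 in D. lra.
Qed.

(** Cutting at half the final height leaves room both for times slightly beyond [t] and for
    neighbouring solutions. *)
Lemma traj_extend (t : R) (u : R -> C) : 0 <= t -> traj t u ->
  exists delta w, 0 < delta /\ (forall s, cut_sol delta w s) /\
    2 * delta = Im (w t) /\ forall s, 0 <= s <= t -> w s = u s.
Proof.
intros t0 H. destruct (H t) as [P1 _]; [lra|].
destruct (cut_flow (Im (u t) / 2) 0 (u 0)) as (w & E & Hw); [lra|].
assert (E' : forall s, 0 <= s <= t -> w s = u s).
{ intros s Hs. destruct (cut_flow_dep (Im (u t) / 2) 0 s w u) as [D _]; auto; try lra.
  - intros r Hr. apply (traj_cut_sol t); auto; lra.
  - apply Cmod_minus_0. rewrite E in D.
    replace (u 0 - u 0)%C with (RtoC 0) in D by ring.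
    rewrite Cmod_0 in D. lra. }
exists (Im (u t) / 2), w. repeat split; try apply Hw; auto; try lra.
rewrite E'; lra.
Qed.

End Loewner.

(** * Tips *)

Lemma is_derive_R_intro (f : R -> R) (s d : R) :
  (forall eps, 0 < eps -> locally s (fun r =>
     Rabs (f r - f s - (r - s) * d) <= eps * Rabs (r - s))) ->
  is_derive f s d.
Proof. intros H. apply (is_derive_C_intro R_AbsRing R_NormedModule), H. Qed.

Lemma is_derive_pos_part_sq (x : R) : is_derive (fun y => Rmax y 0 ^ 2) x (2 * Rmax x 0).
Proof.
apply is_derive_R_intro. intros eps He.
exists (mkposreal eps He). intros y Hy. change R in y.
change (Rabs (y - x) < eps) in Hy.
apply Rle_trans with (Rabs (y - x) * Rabs (y - x)).
2: apply Rmult_le_compat_r; [apply Rabs_pos|lra].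
rewrite <- Rabs_mult, (Rabs_pos_eq ((y - x) * (y - x))) by (apply Rle_0_sqr).
unfold Rmax.
assert (Q := Rle_0_sqr (y - x)). unfold Rsqr in Q.
apply Rabs_le. destruct (Rle_dec y 0), (Rle_dec x 0); split; nra.
Qed.

(** The square of the positive part of [phi] is differentiable and nondecreasing, and vanishes at
    [b]. The sign of [dphi] matters only where [phi] is positive. *)
Lemma nonpos_backward (phi dphi : R -> R) (a b : R) : a <= b ->
  (forall s, a <= s <= b -> is_derive phi s (dphi s)) ->
  (forall s, a <= s <= b -> 0 < phi s -> 0 <= dphi s) ->
  phi b <= 0 -> phi a <= 0.
Proof.
intros ab H Hpos Hb.
assert (D : Rmax (phi a) 0 ^ 2 <= Rmax (phi b) 0 ^ 2).
{ apply (derive_ge_0_incr (fun s => Rmax (phi s) 0 ^ 2)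
    (fun s => dphi s * (2 * Rmax (phi s) 0))); auto.
  - intros s Hs.
    apply (is_derive_comp (V := R_NormedModule) (fun y => Rmax y 0 ^ 2) phi).
    apply is_derive_pos_part_sq. now apply H.
  - intros s Hs. destruct (Rle_lt_dec (phi s) 0).
    rewrite Rmax_right by lra. lra.
    rewrite Rmax_left by lra. apply Rmult_le_pos; [auto|lra]. }
rewrite (Rmax_right (phi b)) in D by lra.
destruct (Rle_lt_dec (phi a) 0); auto.
rewrite Rmax_left in D by lra. nra.
Qed.

Lemma cderiv_sq (u : R -> C) (s : R) (d : C) :
  cderiv u s d -> cderiv (fun r => u r * u r)%C s (2 * (u s * d))%C.
Proof. intros H. eapply cderiv_eq. apply cderiv_mult; eauto. ring. Qed.

Lemma C_complete_rate (z : nat -> C) (c : R) :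
  (forall n m, (n <= m)%nat -> Cmod (z m - z n) <= c * (/ INR (S n))) ->
  exists l, forall eps, 0 < eps -> exists N, forall n, (N <= n)%nat -> Cmod (z n - l) < eps.
Proof.
intros H.
assert (small : forall eps, 0 < eps -> exists N, forall n, (N <= n)%nat -> c * / INR (S n) < eps).
{ intros eps He. destruct (archimed_cor1 (eps / (Rabs c + 1))) as (N & HN & HN').
  { apply Rdiv_lt_0_compat; auto. generalize (Rabs_pos c); lra. }
  exists N. intros n Hn. generalize (Rabs_pos c) (Rle_abs c); intros A1 A2.
  assert (0 < INR N) by now apply lt_0_INR.
  assert (INR N <= INR (S n)) by (apply le_INR; lia).
  assert (/ INR (S n) <= / INR N) by now apply Rinv_le_contravar.
  assert (0 < / INR (S n)) by (apply Rinv_0_lt_compat; lra).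
  apply Rle_lt_trans with ((Rabs c + 1) * / INR (S n)); [nra|].
  apply Rlt_le_trans with ((Rabs c + 1) * (eps / (Rabs c + 1))).
  apply Rmult_lt_compat_l; lra.
  right; field; lra. }
assert (H2 : forall eps : posreal, exists P, eventually P /\
  forall u v, P u -> P v -> ball (z u : C_R_CompleteNormedModule) eps (z v)).
{ intros eps. destruct (small eps (cond_pos eps)) as (N & HN).
  exists (fun n => (N <= n)%nat). split. now exists N.
  intros u v Hu Hv. apply (norm_compat1 (V := C_R_NormedModule)).
  apply Rle_lt_trans with (Cmod (z v - z u)).
  right; symmetry; apply Cmod_norm.
  destruct (Nat.le_ge_cases u v) as [uv|uv].
  eapply Rle_lt_trans; [now apply H|now apply HN].
  rewrite <- Cmod_opp. replace (- (z v - z u))%C with (z u - z v)%C by ring.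
  eapply Rle_lt_trans; [now apply H|now apply HN]. }
destruct (proj1 (filterlim_locally_cauchy (F := eventually)
   (fun n => z n : C_R_CompleteNormedModule)) H2) as (y & Hy).
exists y. intros eps He.
destruct (proj1 (filterlim_locally_ball_norm (U := C_R_NormedModule) _ _) Hy (mkposreal eps He)) as (N & HN).
exists N. intros n Hn. specialize (HN n Hn).
apply Rle_lt_trans with (2 := HN). right. apply Cmod_norm.
Qed.

Section Tips.
Context (lam1 : R -> R) (M : R).
Context (lam1_cont : forall s, continuous lam1 s).
Context (lam1_bound : forall s, Rabs (lam1 s) <= M).
Context (M_pos : 0 < M).

Local Notation traj := (traj lam1).

(** [Re (2 / u)] has the sign of [Re u], so backward in time it pulls towards the imaginary axis;
    only [lam1], of size at most [M], moves the solution away from it. *)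
Lemma traj_back_Re (t s : R) (u : R -> C) : traj t u -> Re (u t) = 0 -> 0 <= s <= t ->
  Rabs (Re (u s)) <= M * (t - s).
Proof.
intros H E Hs.
assert (Dr : forall r, s <= r <= t -> is_derive (fun r => Re (u r)) r
  (2 * Re (u r) / (Re (u r) ^ 2 + Im (u r) ^ 2) - lam1 r)).
{ intros r Hr. destruct (H r) as [_ [Hd _]]; [lra|].
  eapply is_derive_eq; [exact Hd|]. rewrite <- Re_two_div. simpl. ring. }
assert (Hden : forall r, s <= r <= t -> 0 < / (Re (u r) ^ 2 + Im (u r) ^ 2)).
{ intros r Hr. destruct (H r) as [Hp _]; [lra|]. apply Rinv_0_lt_compat. nra. }
assert (Hlam : forall r, - M <= lam1 r <= M).
{ intros r. now apply Rabs_le_between. }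
apply Rabs_le. split.
- cut (- Re (u s) - M * (t - s) <= 0); [lra|].
  apply (nonpos_backward (fun r => - Re (u r) - M * (t - r))
   (fun r => - (2 * Re (u r) / (Re (u r) ^ 2 + Im (u r) ^ 2) - lam1 r) + M) s t); try lra.
  + intros r Hr. eapply is_derive_eq.
    apply (is_derive_minus (fun r => - Re (u r)) (fun r => M * (t - r))).
    apply (is_derive_opp (fun r => Re (u r))). now apply Dr.
    auto_derive; auto.
    unfold minus, plus, opp; simpl. ring.
  + intros r Hr Hp. specialize (Hden r Hr). specialize (Hlam r).
    assert (Re (u r) <= 0) by nra. unfold Rdiv.
    assert (Re (u r) * / (Re (u r) ^ 2 + Im (u r) ^ 2) <= 0) by nra. lra.
- cut (Re (u s) - M * (t - s) <= 0); [lra|].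
  apply (nonpos_backward (fun r => Re (u r) - M * (t - r))
   (fun r => (2 * Re (u r) / (Re (u r) ^ 2 + Im (u r) ^ 2) - lam1 r) + M) s t); try lra.
  + intros r Hr. eapply is_derive_eq.
    apply (is_derive_minus (fun r => Re (u r)) (fun r => M * (t - r))).
    now apply Dr.
    auto_derive; auto.
    unfold minus, plus, opp; simpl. ring.
  + intros r Hr Hp. specialize (Hden r Hr). specialize (Hlam r).
    assert (0 <= Re (u r)) by nra. unfold Rdiv.
    assert (0 <= Re (u r) * / (Re (u r) ^ 2 + Im (u r) ^ 2)) by nra. lra.
Qed.

Lemma traj_sq_deriv (u : R -> C) (s : R) : 0 < Im (u s) -> loewner_sol lam1 u s ->
  cderiv (fun r => u r * u r)%C s (4 - 2 * lam1 s * u s)%C.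
Proof.
intros Hp H. eapply cderiv_eq. apply cderiv_sq, H.
field. now apply C_neq_0_Im.
Qed.

(* Re(u^2) has derivative 4 - 2 lam1 Re u, which lies in [2, 6] as long as M^2 (t - s) <= 1. *)
Lemma traj_back_bounds (t s : R) (u : R -> C) :
  traj t u -> Re (u t) = 0 -> M ^ 2 * t <= 1 -> 0 <= s <= t ->
  Im (u t) ^ 2 + 2 * (t - s) <= Im (u s) ^ 2 /\
  Cmod (u s) ^ 2 <= Im (u t) ^ 2 + 8 * (t - s).
Proof.
intros H E Ht Hs.
assert (Hr : forall r, s <= r <= t -> Rabs (lam1 r * Re (u r)) <= 1).
{ intros r Hr. rewrite Rabs_mult. generalize (traj_back_Re t r u H E ltac:(lra)).
  generalize (lam1_bound r) (Rabs_pos (lam1 r)) (Rabs_pos (Re (u r))). intros.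
  apply Rle_trans with (M * (M * (t - r))); [|nra].
  now apply Rmult_le_compat. }
assert (Dr : forall c r, s <= r <= t -> is_derive (fun r => Re (u r * u r)%C - c * r) r
  (4 - 2 * (lam1 r * Re (u r)) - c)).
{ intros c r Hr'. destruct (H r) as [Hp Hl]; [lra|].
  destruct (traj_sq_deriv u r Hp Hl) as [Hd _].
  eapply is_derive_eq. apply (is_derive_minus (fun r => Re (u r * u r)%C) (fun r => c * r)).
  exact Hd. auto_derive; auto.
  unfold minus, plus, opp; simpl. unfold Re, Im; simpl. ring. }
assert (A1 : Re (u s * u s)%C - 2 * s <= Re (u t * u t)%C - 2 * t).
{ apply (derive_ge_0_incr (fun r => Re (u r * u r)%C - 2 * r) _ s t ltac:(lra) (Dr 2)).
  intros r Hr'. generalize (proj1 (Rabs_le_between _ _) (Hr r Hr')). lra. }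
assert (A2 : Re (u t * u t)%C - 6 * t <= Re (u s * u s)%C - 6 * s).
{ apply (derive_le_0_decr (fun r => Re (u r * u r)%C - 6 * r) _ s t ltac:(lra) (Dr 6)).
  intros r Hr'. generalize (proj1 (Rabs_le_between _ _) (Hr r Hr')). lra. }
(* Since [Cmod (u s) ^ 2 = 2 * Re (u s) ^ 2 - Re (u s * u s)], this adds [2 (t - s)] to the
   [6 (t - s)] of [A2]: hence the constant 8. *)
assert (B : Re (u s) ^ 2 <= t - s).
{ rewrite <- pow2_abs. generalize (traj_back_Re t s u H E ltac:(lra)) (Rabs_pos (Re (u s))).
  intros. apply Rle_trans with ((M * (t - s)) ^ 2).
  now apply pow_incr.
  replace ((M * (t - s)) ^ 2) with ((M ^ 2 * (t - s)) * (t - s)) by ring.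
  rewrite <- (Rmult_1_l (t - s)) at 3. apply Rmult_le_compat_r; [lra|].
  generalize (pow2_ge_0 M). nra. }
rewrite Cmod2_alt.
assert (Sq : forall z : C, Re (z * z) = Re z ^ 2 - Im z ^ 2).
{ intros [x y]; simpl; ring. }
rewrite !Sq, E in *.
generalize (pow2_ge_0 (Re (u s))). lra.
Qed.

(** Squaring is injective on the half-plane because [|z + w| >= Im z]. A height bound on one of the
    two points is enough, so a collapsing solution can be compared with an arbitrary one. *)
Lemma sq_diff_lower (z w : C) : 0 < Im z -> 0 < Im w ->
  Im z * Cmod (z - w) <= Cmod (z * z - w * w).
Proof.
intros Hz Hw.
replace (z * z - w * w)%C with ((z + w) * (z - w))%C by ring.
rewrite Cmod_mult. apply Rmult_le_compat_r; [apply Cmod_ge_0|].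
eapply Rle_trans; [|apply Im_le_Cmod]. eapply Rle_trans; [|apply Rle_abs].
unfold Im in *; simpl. lra.
Qed.

(* The difference f = u^2 - w^2 solves f' = -2 lam1 f / (u + w), whose coefficient is
   O((t - s)^(-1/2)), hence integrable up to the time t at which u degenerates. *)
Lemma sq_diff_compare (b t : R) (u w : R -> C) :
  0 <= b < t -> M ^ 2 * t <= 2 -> traj b u -> traj b w ->
  (forall s, 0 <= s <= b -> sqrt (2 * (t - s)) <= Im (u s)) ->
  Cmod (u b * u b - w b * w b) <= Cmod (u 0 * u 0 - w 0 * w 0) * exp 6 /\
  Cmod (u 0 * u 0 - w 0 * w 0) <= Cmod (u b * u b - w b * w b) * exp 6.
Proof.
intros Hb Ht Hu Hw Hlow.
set (phi s := - (4 * M * sqrt (t - s))).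
set (k s := 2 * M / sqrt (t - s)).
destruct (gronwall_C (fun s => u s * u s - w s * w s)%C
  (fun s => - (2 * lam1 s * (u s - w s)))%C k phi 0 b) as [G1 G2]; try lra.
- intros s Hs. destruct (Hu s Hs) as [P1 L1], (Hw s Hs) as [P2 L2].
  eapply cderiv_eq. apply cderiv_minus; apply traj_sq_deriv; auto. ring.
- intros s Hs. unfold phi, k. assert (0 < sqrt (t - s)) by (apply sqrt_lt_R0; lra).
  auto_derive. lra. unfold Rminus in *. field. lra.
- intros s Hs. destruct (Hu s Hs) as [P1 L1], (Hw s Hs) as [P2 L2].
  assert (S0 : 0 < sqrt (t - s)) by (apply sqrt_lt_R0; lra).
  assert (S1 : sqrt (t - s) <= Im (u s)).
  { eapply Rle_trans; [|apply Hlow; auto]. apply sqrt_le_1_alt; lra. }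
  rewrite Cmod_opp, !Cmod_mult, !Cmod_R, (Rabs_pos_eq 2) by lra.
  unfold k.
  apply Rle_trans with (2 * M / sqrt (t - s) * (sqrt (t - s) * Cmod (u s - w s))).
  + replace (2 * M / sqrt (t - s) * (sqrt (t - s) * Cmod (u s - w s)))
      with (2 * M * Cmod (u s - w s)) by (field; lra).
    apply Rmult_le_compat_r; [apply Cmod_ge_0|]. generalize (lam1_bound s); lra.
  + apply Rmult_le_compat_l. left; apply Rdiv_lt_0_compat; lra.
    eapply Rle_trans; [|now apply sq_diff_lower].
    apply Rmult_le_compat_r; [apply Cmod_ge_0|auto].
- assert (X : exp (phi b - phi 0) <= exp 6).
  {     assert (Y : phi b - phi 0 <= 6).
    { unfold phi. rewrite Rminus_0_r.
      assert (0 <= 4 * M * sqrt (t - b)) by (generalize (sqrt_pos (t - b)); nra).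
      (* [M ^ 2 * t <= 2 <= 9 / 4]; the exponent is then at most [4 * (3 / 2) = 6]. *)
      assert (M * sqrt t <= 3 / 2).
      { apply Rsqr_incr_0_var; [|lra]. rewrite Rsqr_mult, Rsqr_sqrt by lra.
        unfold Rsqr. nra. }
      nra. }
    destruct (Rle_lt_or_eq_dec _ _ Y) as [Z|Z]; [left; now apply exp_increasing|rewrite Z; lra]. }
  split.
  eapply Rle_trans; [exact G1|]. apply Rmult_le_compat_l; [apply Cmod_ge_0|auto].
  eapply Rle_trans; [exact G2|]. apply Rmult_le_compat_l; [apply Cmod_ge_0|auto].
Qed.

(** The point whose solution hits 0 at time [t]. As the equation makes no sense at 0, this is
    expressed on every [[0, b]] with [b < t]; the upper bound says that the solution tends to 0, the
    lower bound is what the comparison of squares requires. *)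
Definition tip (t : R) (z : C) : Prop :=
  forall b, 0 <= b < t -> exists u, traj b u /\ u 0 = z /\
    forall s, 0 <= s <= b ->
      sqrt (2 * (t - s)) <= Im (u s) /\ Cmod (u s) <= sqrt (8 * (t - s)).

Lemma sqrt_le_of_sq (x y : R) : 0 <= y -> x <= y ^ 2 -> sqrt x <= y.
Proof.
intros Hy H. rewrite <- (sqrt_pow2 y Hy). now apply sqrt_le_1_alt.
Qed.

Lemma tip_exists (t : R) : 0 < t -> M ^ 2 * t <= 1 -> exists z, tip t z.
Proof.
intros t0 Ht.
(* The factor [1 / M] makes [M * e n = 1 / (n + 1) <= 1], so the end heights are small on the scale
   set by the drift. *)
set (e n := / (M * INR (S n))).
assert (e_pos : forall n, 0 < e n).
{ intros n. apply Rinv_0_lt_compat, Rmult_lt_0_compat; auto. apply lt_0_INR; lia. }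
assert (e_le : forall n, M * e n = / INR (S n)).
{ intros n. unfold e. field. split; try lra. apply not_0_INR; lia. }
assert (inv_le : forall n, 0 < / INR (S n) <= 1).
{ intros n. split. apply Rinv_0_lt_compat, lt_0_INR; lia.
  rewrite <- Rinv_1. apply Rinv_le_contravar; [lra|].
  replace 1 with (INR 1) by reflexivity. apply le_INR; lia. }
assert (e_mono : forall n m, (n <= m)%nat -> e m <= e n).
{ intros n m nm. apply Rmult_le_reg_l with M; auto. rewrite !e_le.
  apply Rinv_le_contravar. apply lt_0_INR; lia. apply le_INR; lia. }
assert (Hu : forall n, exists u, traj t u /\ Re (u t) = 0 /\ Im (u t) = e n).
{ intros n. destruct (cut_flow lam1 M lam1_cont lam1_bound (e n) t (0, e n)) as (u & E & Hu); auto.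
  exists u. rewrite E. split; [|split; reflexivity].
  apply (cut_sol_traj lam1 t (e n)); auto. rewrite E; simpl; lra. }
destruct (choice _ Hu) as (u & Hun). clear Hu.
assert (Bnd : forall n s, 0 <= s <= t -> e n ^ 2 + 2 * (t - s) <= Im (u n s) ^ 2 /\
  Cmod (u n s) ^ 2 <= e n ^ 2 + 8 * (t - s)).
{ intros n s Hs. destruct (Hun n) as (T & R0 & I0). rewrite <- I0.
  now apply traj_back_bounds. }
assert (Ipos : forall n s, 0 <= s <= t -> 0 < Im (u n s)).
{ intros n s Hs. destruct (Hun n) as (T & _). now apply T. }
assert (low : forall n s, 0 <= s <= t -> sqrt (2 * (t - s)) <= Im (u n s)).
{ intros n s Hs. apply sqrt_le_of_sq. left; auto.
  destruct (Bnd n s Hs). generalize (pow2_ge_0 (e n)). lra. }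
assert (S0 : 0 < sqrt (2 * t)) by (apply sqrt_lt_R0; lra).
(* The constant collects [sqrt (2 t) |u n 0 - u m 0| <= |(u n 0)^2 - (u m 0)^2| <= exp 6 * (e n)^2]
   and [(e n)^2 <= 1 / (M^2 (n + 1))]. *)
destruct (C_complete_rate (fun n => u n 0) (exp 6 / M ^ 2 / sqrt (2 * t))) as (z & Hz).
{ intros n m nm.
  (* A solution of height [e n] at time [t] obeys the lower bound of one collapsing at
     [t + e n ^ 2 / 2]. The comparison thus reaches [t] itself, and this is why it admits
     [M ^ 2 * t] up to 2. *)
  destruct (sq_diff_compare t (t + e n ^ 2 / 2) (u n) (u m)) as [_ D].
  - generalize (pow_lt (e n) 2 (e_pos n)). lra.
  - assert (M ^ 2 * (e n ^ 2 / 2) <= 1).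
    { replace (M ^ 2 * (e n ^ 2 / 2)) with ((M * e n) ^ 2 / 2) by field.
      rewrite e_le. generalize (inv_le n). nra. }
    lra.
  - apply Hun.
  - apply Hun.
  - intros s Hs. apply sqrt_le_of_sq. left; auto.
    destruct (Bnd n s Hs). lra.
  - destruct (Hun n) as (_ & Rn & In), (Hun m) as (_ & Rm & Im').
    assert (Cmod (u n t * u n t - u m t * u m t) <= e n ^ 2).
    { destruct (u n t) as [x y], (u m t) as [x' y']; simpl in Rn, In, Rm, Im'.
      subst x x' y y'.
      replace ((0, e n) * (0, e n) - (0, e m) * (0, e m))%C with (RtoC (e m ^ 2 - e n ^ 2)).
      2: { unfold Cminus, Cmult, Copp, Cplus, RtoC; simpl; f_equal; ring. }
      rewrite Cmod_R. apply Rabs_le. generalize (e_mono n m nm) (e_pos m). nra. }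
    replace (u m 0 - u n 0)%C with (- (u n 0 - u m 0))%C by ring. rewrite Cmod_opp.
    apply Rmult_le_reg_l with (sqrt (2 * t)); auto.
    replace (sqrt (2 * t) * (exp 6 / M ^ 2 / sqrt (2 * t) * / INR (S n)))
      with (/ INR (S n) / M ^ 2 * exp 6).
    2: { field. repeat split; try lra. apply not_0_INR; lia. }
    apply Rle_trans with (e n ^ 2 * exp 6).
    + eapply Rle_trans; [|eapply Rle_trans; [exact D|]].
      * eapply Rle_trans; [|apply sq_diff_lower; apply Ipos; lra].
        apply Rmult_le_compat_r; [apply Cmod_ge_0|].
        generalize (low n 0 ltac:(lra)). now rewrite Rminus_0_r.
      * apply Rmult_le_compat_r; auto. left; apply exp_pos.
    + apply Rmult_le_compat_r. left; apply exp_pos.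
      apply Rmult_le_reg_l with (M ^ 2). apply pow_lt; lra.
      replace (M ^ 2 * e n ^ 2) with ((M * e n) ^ 2) by ring. rewrite e_le.
      replace (M ^ 2 * (/ INR (S n) / M ^ 2)) with (/ INR (S n)).
      2: { field. split; try lra. apply not_0_INR; lia. }
      generalize (inv_le n). nra. }
exists z. intros b Hb.
(* On [[0, b]] all approximating solutions stay above [d], so they solve the equation cut at [d] and
   depend continuously on their initial points. *)
set (d := sqrt (2 * (t - b))).
assert (d0 : 0 < d) by (apply sqrt_lt_R0; lra).
destruct (cut_flow lam1 M lam1_cont lam1_bound d 0 z) as (w & E & Hw); auto.
assert (close : forall s eta, 0 <= s <= b -> 0 < eta -> exists n,
   Cmod (u n s - w s) <= eta /\ e n <= eta).
{ intros s eta Hs He.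
  destruct (Hz (eta * exp (- (2 / d ^ 2 * (s - 0))))) as (N & HN).
  { apply Rmult_lt_0_compat; auto. apply exp_pos. }
  destruct (archimed_cor1 (M * eta)) as (N' & HN' & HN0').
  { now apply Rmult_lt_0_compat. }
  exists (N + N')%nat. split.
  - destruct (cut_flow_dep lam1 d 0 s (u (N + N')%nat) w) as [D _]; auto; try lra.
    + intros r Hr. apply loewner_cut_sol; [|apply Hun; lra].
      eapply Rle_trans; [|apply low; lra]. apply sqrt_le_1_alt. lra.
    + eapply Rle_trans; [exact D|]. rewrite E.
      specialize (HN (N + N')%nat ltac:(lia)).
      rewrite exp_Ropp in HN.
      assert (P := exp_pos (2 / d ^ 2 * (s - 0))).
      apply Rmult_lt_compat_r with (r := exp (2 / d ^ 2 * (s - 0))) in HN; auto.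
      rewrite Rmult_assoc, Rinv_l, Rmult_1_r in HN; lra.
  - apply Rmult_le_reg_l with M; auto. rewrite e_le.
    eapply Rle_trans; [|left; exact HN'].
    apply Rinv_le_contravar. now apply lt_0_INR. apply le_INR; lia. }
(* The bounds pass to the limit, and the lower one shows that the cut is inactive along [w]. *)
assert (Good : forall s, 0 <= s <= b ->
  sqrt (2 * (t - s)) <= Im (w s) /\ Cmod (w s) <= sqrt (8 * (t - s))).
{ intros s Hs. split; apply le_epsilon; intros eta He.
  - destruct (close s eta Hs He) as (n & Hn & _).
    generalize (low n s ltac:(lra)).
    generalize (Rle_trans _ _ _ (Im_le_Cmod (u n s - w s)) Hn) (Rle_abs (Im (u n s - w s))).
    unfold Im; simpl. unfold Rminus. lra.
  - destruct (close s (eta / 2) Hs ltac:(lra)) as (n & Hn & Hen).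
    destruct (Bnd n s ltac:(lra)) as [_ B].
    assert (B' : Cmod (u n s) <= e n + sqrt (8 * (t - s))).
    { apply Rsqr_incr_0_var.
      2: generalize (sqrt_pos (8 * (t - s))) (e_pos n); lra.
      rewrite !Rsqr_pow2. eapply Rle_trans; [exact B|].
      assert (Q := pow2_sqrt (8 * (t - s)) ltac:(lra)).
      generalize (sqrt_pos (8 * (t - s))) (e_pos n). nra. }
    replace (w s) with (u n s + - (u n s - w s))%C by ring.
    eapply Rle_trans; [apply Cmod_triangle|]. rewrite Cmod_opp. lra. }
exists w. split; [|split; auto].
intros s Hs. destruct (Good s Hs) as [G1 _].
assert (d <= Im (w s)).
{ eapply Rle_trans; [|exact G1]. apply sqrt_le_1_alt; lra. }
split; [lra|]. now apply (cut_sol_loewner lam1 d).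
Qed.

Lemma tip_Im (t : R) (z : C) : 0 < t -> tip t z -> sqrt (2 * t) <= Im z /\ Cmod z <= sqrt (8 * t).
Proof.
intros t0 H. destruct (H 0) as (u & Hu & <- & B); [lra|].
generalize (B 0 ltac:(lra)). now rewrite Rminus_0_r.
Qed.

(** Limit [b -> t] of the comparison of squares: the solution of the tip satisfies
    [|u b|^2 <= 8 (t - b)] and disappears, leaving [|w t|^2]. A solution thus ends near 0 exactly
    when it starts near the tip, in terms of squares. *)
Lemma tip_compare (t : R) (z : C) (w : R -> C) : 0 < t -> M ^ 2 * t <= 1 -> tip t z -> traj t w ->
  Cmod (z * z - w 0 * w 0) <= Cmod (w t) ^ 2 * exp 6 /\
  Cmod (w t) ^ 2 <= Cmod (z * z - w 0 * w 0) * exp 6.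
Proof.
intros t0 Ht Hz Hw.
assert (E6 := exp_pos 6).
assert (App : forall eta, 0 < eta -> exists b, 0 <= b < t /\ 8 * (t - b) <= eta /\
  Rabs (Cmod (w b) ^ 2 - Cmod (w t) ^ 2) <= eta).
{ intros eta He.
  assert (Cn : continuity_pt (fun r => Cmod (w r) ^ 2) t).
  { eapply is_derive_continuity, is_derive_Cmod2. apply (Hw t); lra. }
  destruct (Cn eta He) as (d & Hd & Hc).
  set (h := Rmin (Rmin (d / 2) (eta / 8)) t).
  assert (h0 : 0 < h) by (repeat apply Rmin_pos; lra).
  assert (h1 : h <= d / 2) by (unfold h; eapply Rle_trans; [apply Rmin_l|apply Rmin_l]).
  assert (h2 : h <= eta / 8) by (unfold h; eapply Rle_trans; [apply Rmin_l|apply Rmin_r]).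
  assert (h3 : h <= t) by apply Rmin_r.
  exists (t - h). repeat split; try lra.
  left. apply (Hc (t - h)). split. split. exact I. lra.
  simpl. unfold R_dist. rewrite Rabs_left; lra. }
assert (K : forall b, 0 <= b < t ->
  Cmod (z * z - w 0 * w 0) <= (8 * (t - b) + Cmod (w b) ^ 2) * exp 6 /\
  Cmod (w b) ^ 2 <= 8 * (t - b) + Cmod (z * z - w 0 * w 0) * exp 6).
{ intros b Hb. destruct (Hz b Hb) as (u & Hu & <- & B).
  destruct (sq_diff_compare b t u w) as [D1 D2]; auto; try lra.
  - apply (traj_restrict lam1 b t); auto; lra.
  - intros s Hs. now apply B.
  - destruct (B b) as [_ B2]; [lra|].
    assert (U : Cmod (u b * u b) <= 8 * (t - b)).
    { rewrite Cmod_mult. rewrite <- (sqrt_sqrt (8 * (t - b))) by lra.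
      apply Rmult_le_compat; auto; apply Cmod_ge_0. }
    assert (W : Cmod (w b * w b) = Cmod (w b) ^ 2) by (rewrite Cmod_mult; ring).
    split.
    + eapply Rle_trans; [exact D2|]. apply Rmult_le_compat_r; [lra|].
      eapply Rle_trans; [apply Cmod_triangle|]. rewrite Cmod_opp, W. lra.
    + rewrite <- W. replace (w b * w b)%C with (u b * u b + - (u b * u b - w b * w b))%C by ring.
      eapply Rle_trans; [apply Cmod_triangle|]. rewrite Cmod_opp. lra. }
split; apply le_epsilon; intros eta He.
- destruct (App (eta / (2 * exp 6))) as (b & Hb & B1 & B2).
  { apply Rdiv_lt_0_compat; lra. }
  destruct (K b Hb) as [K1 _]. eapply Rle_trans; [exact K1|].
  apply Rabs_le_between in B2.
  apply Rle_trans with ((Cmod (w t) ^ 2 + 2 * (eta / (2 * exp 6))) * exp 6).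
  apply Rmult_le_compat_r; lra.
  right. field. lra.
- destruct (App (eta / 2)) as (b & Hb & B1 & B2); [lra|].
  destruct (K b Hb) as [_ K2]. apply Rabs_le_between in B2. lra.
Qed.

End Tips.

(** * The Loewner curve *)

Section Curve.
Context (lam1 : R -> R) (M : R).
Context (lam1_cont : forall s, continuous lam1 s).
Context (lam1_bound : forall s, Rabs (lam1 s) <= M).
Context (M_pos : 0 < M).

Local Notation traj := (traj lam1).
Local Notation tip := (tip lam1).

(** Time 0 is set apart because [tip 0] holds vacuously of every point. *)
Definition loewner_curve (t : R) : C :=
  if Rlt_dec 0 t then epsilon (inhabits (RtoC 0)) (tip t) else RtoC 0.

Local Notation gam := loewner_curve.

Lemma gam_0 : gam 0 = RtoC 0.
Proof. unfold gam. destruct Rlt_dec; [lra|auto]. Qed.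

Lemma gam_tip (t : R) : 0 < t -> M ^ 2 * t <= 1 -> tip t (gam t).
Proof.
intros t0 Ht. unfold gam. destruct Rlt_dec; [|lra].
apply epsilon_spec. now apply (tip_exists lam1 M).
Qed.

Lemma gam_bounds (t : R) : 0 < t -> M ^ 2 * t <= 1 ->
  sqrt (2 * t) <= Im (gam t) /\ Cmod (gam t) <= sqrt (8 * t).
Proof. intros t0 Ht. apply (tip_Im lam1); auto. now apply gam_tip. Qed.

Lemma gam_inH (t : R) : 0 < t -> M ^ 2 * t <= 1 -> 0 < Im (gam t).
Proof.
intros t0 Ht. apply Rlt_le_trans with (2 := proj1 (gam_bounds t t0 Ht)).
apply sqrt_lt_R0; lra.
Qed.

(** * Continuity and injectivity of the curve *)

Lemma M_sq_le (s t : R) : s <= t -> M ^ 2 * t <= 1 -> M ^ 2 * s <= 1.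
Proof. intros st Ht. generalize (pow2_ge_0 M). nra. Qed.

(** The comparison of [w] with the tip at its own starting point gives [|w t|^2 <= 0], against
    [Im (w t) > 0]. *)
Lemma tip_unreached (t : R) (w : R -> C) : 0 < t -> M ^ 2 * t <= 1 ->
  tip t (w 0) -> traj t w -> False.
Proof.
intros t0 Ht Hz Hw.
destruct (tip_compare lam1 M lam1_bound M_pos t (w 0) w) as [_ D]; auto.
replace (w 0 * w 0 - w 0 * w 0)%C with (RtoC 0) in D by ring.
rewrite Cmod_0 in D.
destruct (Hw t) as [P _]; [lra|]. apply Cmod_pos_Im in P. nra.
Qed.

(** The solution started at [gam t] still exists at time [s], with square modulus at most
    [8 (t - s)]; comparing it there with the tip [gam s] gives the bound. *)
Lemma gam_sq_lip (s t : R) : 0 <= s <= t -> M ^ 2 * t <= 1 ->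
  Cmod (gam s * gam s - gam t * gam t) <= 8 * exp 6 * (t - s).
Proof.
intros Hs Ht.
assert (E6 : 1 <= exp 6) by (generalize (exp_ineq1_le 6); lra).
destruct (Req_dec s t) as [->|st].
{ replace (gam t * gam t - gam t * gam t)%C with (RtoC 0) by ring.
  rewrite Cmod_0. nra. }
destruct (gam_tip t ltac:(lra) Ht s ltac:(lra)) as (u & Hu & E & B).
destruct (Req_dec s 0) as [->|s0].
- rewrite gam_0. destruct (gam_bounds t ltac:(lra) Ht) as [_ G].
  replace (0 * 0 - gam t * gam t)%C with (- (gam t * gam t))%C by ring.
  rewrite Cmod_opp, Cmod_mult.
  assert (Cmod (gam t) * Cmod (gam t) <= 8 * t).
  { rewrite <- (sqrt_sqrt (8 * t)) by lra.
    apply Rmult_le_compat; auto; apply Cmod_ge_0. }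
  nra.
- destruct (tip_compare lam1 M lam1_bound M_pos s (gam s) u) as [D _]; auto; try lra.
  now apply (M_sq_le s t). apply gam_tip; [lra|]. now apply (M_sq_le s t).
  rewrite E in D. eapply Rle_trans; [exact D|].
  replace (8 * exp 6 * (t - s)) with (8 * (t - s) * exp 6) by ring.
  apply Rmult_le_compat_r; [lra|].
  destruct (B s ltac:(lra)) as [_ B2].
  rewrite <- (sqrt_sqrt (8 * (t - s))) by lra.
  replace (Cmod (u s) ^ 2) with (Cmod (u s) * Cmod (u s)) by ring.
  apply Rmult_le_compat; auto; apply Cmod_ge_0.
Qed.

Lemma gam_holder (s t : R) : 0 <= s <= t -> M ^ 2 * t <= 1 ->
  Cmod (gam s - gam t) ^ 2 <= 32 * exp 6 ^ 2 * (t - s).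
Proof.
intros Hs Ht.
destruct (Req_dec s t) as [->|st].
{ replace (gam t - gam t)%C with (RtoC 0) by ring. rewrite Cmod_0. nra. }
assert (L := gam_sq_lip s t Hs Ht).
replace (gam s * gam s - gam t * gam t)%C with ((gam s + gam t) * (gam s - gam t))%C in L by ring.
rewrite Cmod_mult in L.
(* Dividing the squared Lipschitz bound [64 exp(6)^2 (t - s)^2] by this leaves the constant 32,
   uniformly down to time 0. *)
assert (S2 : 2 * (t - s) <= Cmod (gam s + gam t) ^ 2).
{ apply Rle_trans with (Im (gam t) ^ 2).
  - apply Rle_trans with (sqrt (2 * t) ^ 2). rewrite pow2_sqrt; lra.
    apply pow_incr. split. apply sqrt_pos. apply gam_bounds; auto; lra.
  - apply pow_incr. assert (P := gam_inH t ltac:(lra) Ht). split; [lra|].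
    eapply Rle_trans; [|apply Im_le_Cmod]. eapply Rle_trans; [|apply Rle_abs].
    assert (0 <= Im (gam s)).
    { destruct (Req_dec s 0) as [->|]. rewrite gam_0. simpl; lra.
      left. apply gam_inH; [lra|]. now apply (M_sq_le s t). }
    unfold Im in *; simpl. lra. }
assert (L2 : (Cmod (gam s + gam t) * Cmod (gam s - gam t)) ^ 2 <= (8 * exp 6 * (t - s)) ^ 2).
{ apply pow_incr. split; auto. apply Rmult_le_pos; apply Cmod_ge_0. }
rewrite Rpow_mult_distr in L2.
assert (Q := pow2_ge_0 (Cmod (gam s - gam t))).
apply Rmult_le_reg_l with (2 * (t - s)); [lra|]. nra.
Qed.

Lemma gam_continuous (tau : R) : M ^ 2 * tau <= 1 ->
  forall t, 0 <= t < tau -> forall eps, 0 < eps -> exists delta, 0 < delta /\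
    forall s, 0 <= s < tau -> Rabs (s - t) < delta -> Cmod (gam s - gam t)%C < eps.
Proof.
intros Htau t Ht eps He.
set (c := 32 * exp 6 ^ 2).
assert (c0 : 0 < c).
{ unfold c. generalize (pow_lt (exp 6) 2 (exp_pos 6)). lra. }
exists (eps ^ 2 / c). split. apply Rdiv_lt_0_compat; auto. apply pow_lt; auto.
intros s Hs Hd.
assert (A : Cmod (gam s - gam t) ^ 2 <= c * Rabs (s - t)).
{ destruct (Rle_dec s t).
  - rewrite Rabs_left1 by lra. replace (- (s - t)) with (t - s) by ring.
    apply gam_holder; [lra|]. apply (M_sq_le t tau); lra.
  - rewrite Rabs_pos_eq by lra. rewrite <- Cmod_opp.
    replace (- (gam s - gam t))%C with (gam t - gam s)%C by ring.
    apply gam_holder; [lra|]. apply (M_sq_le s tau); lra. }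
assert (B : c * Rabs (s - t) < eps ^ 2).
{ apply Rlt_le_trans with (c * (eps ^ 2 / c)). apply Rmult_lt_compat_l; auto.
  right; field; lra. }
apply Rsqr_incrst_0; [|apply Cmod_ge_0|lra].
rewrite !Rsqr_pow2. lra.
Qed.

(** The solution started at [gam t] survives past [s < t], which no solution started at the tip of
    time [s] can do. *)
Lemma gam_injective (s t : R) : 0 <= s < t -> M ^ 2 * t <= 1 -> gam s <> gam t.
Proof.
intros Hs Ht E.
destruct (Req_dec s 0) as [->|s0].
- assert (P := gam_inH t ltac:(lra) Ht). rewrite <- E, gam_0 in P. simpl in P; lra.
- destruct (gam_tip t ltac:(lra) Ht s ltac:(lra)) as (u & Hu & E' & _).
  assert (Hs' : M ^ 2 * s <= 1) by (apply (M_sq_le s t); lra).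
  apply (tip_unreached s u); auto; try lra.
  rewrite E', <- E. apply gam_tip; auto; lra.
Qed.

Lemma curve_H_gam (tau : R) : M ^ 2 * tau <= 1 -> curve_H gam tau.
Proof.
intros Htau. split; [|split; [|split]].
- now apply gam_continuous.
- intros s t Hs Ht E.
  destruct (Rtotal_order s t) as [st|[st|st]]; auto; exfalso.
  + apply (gam_injective s t); auto; [lra|]. apply (M_sq_le t tau); lra.
  + apply (gam_injective t s); auto; [lra|]. apply (M_sq_le s tau); lra.
- intros t Ht. apply gam_inH; [lra|]. apply (M_sq_le t tau); lra.
- apply gam_0.
Qed.

(** * Surviving initial points are the points off the curve *)

Lemma slit_dom_of_traj (t : R) (u : R -> C) : 0 <= t -> M ^ 2 * t <= 1 -> traj t u ->
  slit_dom gam t (u 0).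
Proof.
intros t0 Ht Hu. split. apply Hu; lra.
intros s Hs E.
assert (Hs' : M ^ 2 * s <= 1) by (apply (M_sq_le s t); lra).
apply (tip_unreached s u); try lra.
- rewrite E. apply gam_tip; auto; lra.
- apply (traj_restrict lam1 s t); auto; lra.
Qed.

Lemma lipschitz_continuity_pt (f : R -> R) (K x : R) :
  (forall y, Rabs (f y - f x) <= K * Rabs (y - x)) -> continuity_pt f x.
Proof.
intros H eps He. 
exists (eps / (Rabs K + 1)). split.
{ apply Rdiv_lt_0_compat; auto. generalize (Rabs_pos K); lra. }
intros y [_ Hy]. simpl in *. unfold R_dist in *.
eapply Rle_lt_trans; [apply H|].
generalize (Rabs_pos K) (Rle_abs K) (Rabs_pos (y - x)). intros.
apply Rle_lt_trans with ((Rabs K + 1) * Rabs (y - x)); [nra|].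
apply Rlt_le_trans with ((Rabs K + 1) * (eps / (Rabs K + 1))).
apply Rmult_lt_compat_l; lra. right; field; lra.
Qed.

(** The distance is taken between squares because that is what [tip_compare] controls. It attains
    its minimum on the compact interval, and [gam m + z] cannot vanish since its imaginary part is
    positive. *)
Lemma slit_dom_distance (t : R) (z : C) : 0 <= t -> M ^ 2 * t <= 1 -> slit_dom gam t z ->
  exists d, 0 < d /\ forall r, 0 <= r <= t -> d <= Cmod (gam r * gam r - z * z).
Proof.
intros t0 Ht [Hz Hs]. red in Hz.
(* The minimum theorem asks for two-sided continuity at the ends of the interval, hence the constant
   extension. *)
set (cl r := Rmax 0 (Rmin r t)).
assert (cl_in : forall r, 0 <= cl r <= t).
{ intros r. unfold cl, Rmax, Rmin. repeat destruct Rle_dec; lra. }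
assert (cl_id : forall r, 0 <= r <= t -> cl r = r).
{ intros r Hr. unfold cl. rewrite Rmin_left, Rmax_right; lra. }
assert (cl_lip : forall r r', Rabs (cl r - cl r') <= Rabs (r - r')).
{ intros r r'. unfold cl, Rmax, Rmin, Rabs.
  repeat destruct Rle_dec; repeat destruct Rcase_abs; lra. }
assert (E6 := exp_pos 6).
assert (Lip : forall r r', 0 <= r <= t -> 0 <= r' <= t ->
  Cmod (gam r * gam r - gam r' * gam r') <= 8 * exp 6 * Rabs (r - r')).
{ intros r r' Hr Hr'. destruct (Rle_dec r r').
  - rewrite Rabs_left1 by lra. replace (- (r - r')) with (r' - r) by ring.
    apply gam_sq_lip; [lra|]. apply (M_sq_le r' t); lra.
  - rewrite Rabs_pos_eq by lra. rewrite <- Cmod_opp.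
    replace (- (gam r * gam r - gam r' * gam r'))%C with (gam r' * gam r' - gam r * gam r)%C by ring.
    apply gam_sq_lip; [lra|]. apply (M_sq_le r t); lra. }
set (F r := Cmod (gam (cl r) * gam (cl r) - z * z)).
destruct (continuity_ab_min F 0 t t0) as (m & Hm & m_in).
{ intros c Hc. apply lipschitz_continuity_pt with (8 * exp 6). intros y. unfold F.
  apply Rle_trans with (Cmod (gam (cl y) * gam (cl y) - gam (cl c) * gam (cl c))).
  - set (p := (gam (cl y) * gam (cl y))%C). set (q := (gam (cl c) * gam (cl c))%C).
    apply Rabs_le. split.
    + generalize (Cmod_triangle (- (p - q)) (p - z * z)). rewrite Cmod_opp.
      replace (- (p - q) + (p - z * z))%C with (q - z * z)%C by ring. lra.
    + generalize (Cmod_triangle (p - q) (q - z * z)).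
      replace (p - q + (q - z * z))%C with (p - z * z)%C by ring. lra.
  - eapply Rle_trans; [apply Lip; auto|]. apply Rmult_le_compat_l; auto; lra. }
exists (F m). split.
- unfold F. rewrite (cl_id m m_in). apply Cmod_gt_0.
  replace (gam m * gam m - z * z)%C with ((gam m + z) * (gam m - z))%C by ring.
  (* The slit domain excludes only [gam s] with [s > 0]; at time 0 it is [Im z > 0] that keeps [z]
     off the curve. *)
  destruct (Req_dec m 0) as [->|m0].
  + rewrite gam_0. apply Cmult_neq_0; intros E; apply (f_equal Im) in E;
      unfold Im in *; simpl in E; lra.
  + apply Cmult_neq_0; intros E.
    * apply (f_equal Im) in E. assert (P := gam_inH m ltac:(lra) (M_sq_le m t ltac:(lra) Ht)).
      unfold Im in *; simpl in E; lra.
    * apply (Hs m); [lra|]. replace z with (gam m - (gam m - z))%C by ring. rewrite E. ring.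
- intros r Hr. generalize (Hm r Hr). unfold F. now rewrite (cl_id r Hr).
Qed.

(** The logarithm of [Im u] has derivative [-2 / |u|^2], so keeping [u] away from 0 keeps it away
    from the real line. *)
Lemma traj_Im_lower (t m : R) (u : R -> C) : 0 <= t -> 0 < m -> traj t u ->
  (forall s, 0 <= s <= t -> m <= Cmod (u s) ^ 2) ->
  Im (u 0) * exp (- (2 / m * t)) <= Im (u t).
Proof.
intros t0 m0 Hu Hm.
assert (D : Im (u 0) * exp (2 / m * 0) <= Im (u t) * exp (2 / m * t)).
{ apply (derive_ge_0_incr (fun s => Im (u s) * exp (2 / m * s))
   (fun s => (2 / m * Im (u s) - 2 * Im (u s) / (Re (u s) ^ 2 + Im (u s) ^ 2)) * exp (2 / m * s)));
   auto.
  - intros s Hs. destruct (Hu s Hs) as [P [_ L]].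
    eapply is_derive_eq.
    apply (is_derive_mult (K := R_AbsRing) (fun s => Im (u s)) (fun s => exp (2 / m * s)));
      [exact L| |exact Rmult_comm].
    auto_derive; auto.
    replace (Im (2 / u s - lam1 s)) with (Im (2 / u s)) by (simpl; ring).
    rewrite Im_two_div. unfold plus, mult; simpl. 
    unfold Rdiv. ring.
  - intros s Hs. destruct (Hu s Hs) as [P _]. specialize (Hm s Hs). rewrite Cmod2_alt in Hm.
    apply Rmult_le_pos; [|left; apply exp_pos].
    replace (2 / m * Im (u s) - 2 * Im (u s) / (Re (u s) ^ 2 + Im (u s) ^ 2))
      with (2 * Im (u s) * (/ m - / (Re (u s) ^ 2 + Im (u s) ^ 2))) by (field; lra).
    apply Rmult_le_pos; [lra|].
    assert (/ (Re (u s) ^ 2 + Im (u s) ^ 2) <= / m) by now apply Rinv_le_contravar. lra. }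
rewrite Rmult_0_r, exp_0, Rmult_1_r in D.
rewrite exp_Ropp. assert (P := exp_pos (2 / m * t)).
apply Rmult_le_reg_r with (exp (2 / m * t)); auto.
rewrite Rmult_assoc, Rinv_l; lra.
Qed.

(** A bootstrap: as long as the solution survives, comparison with the tips keeps it away from 0,
    hence at height at least [c]. The equation is cut at the smaller height [c / 2], which the
    solution therefore never reaches. *)
Lemma traj_of_slit_dom (t : R) (z : C) : 0 <= t -> M ^ 2 * t <= 1 -> slit_dom gam t z ->
  exists u, traj t u /\ u 0 = z.
Proof.
intros t0 Ht Hz.
destruct (slit_dom_distance t z t0 Ht Hz) as (d & d0 & Hd).
destruct Hz as [Hz _]. red in Hz.
assert (E6 : 1 <= exp 6) by (generalize (exp_ineq1_le 6); lra).
set (m := d / exp 6).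
assert (m0 : 0 < m) by (apply Rdiv_lt_0_compat; lra).
assert (far : forall r w, 0 <= r <= t -> traj r w -> w 0 = z -> m <= Cmod (w r) ^ 2).
{ intros r w Hr Hw E. apply Rmult_le_reg_r with (exp 6); [lra|].
  unfold m. replace (d / exp 6 * exp 6) with d by (field; lra).
  eapply Rle_trans; [apply (Hd r Hr)|].
  destruct (Req_dec r 0) as [->|r0].
  - rewrite gam_0, E. replace (0 * 0 - z * z)%C with (- (z * z))%C by ring.
    rewrite Cmod_opp, Cmod_mult. generalize (Cmod_ge_0 z). intros.
    assert (0 <= Cmod z * Cmod z) by now apply Rmult_le_pos. nra.
  - rewrite <- E. apply (tip_compare lam1 M lam1_bound M_pos r); auto; try lra.
    apply (M_sq_le r t); lra. apply gam_tip; [lra|]. apply (M_sq_le r t); lra. }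
set (c := Im z * exp (- (2 / m * t))).
assert (c0 : 0 < c) by (apply Rmult_lt_0_compat; [auto|apply exp_pos]).
destruct (cut_flow lam1 M lam1_cont lam1_bound (c / 2) 0 z) as (w & E & Hw); [lra|].
assert (key : forall r, 0 <= r <= t -> c / 2 <= Im (w r) -> c <= Im (w r)).
{ intros r Hr Hi.
  assert (Tr : traj r w) by (apply (cut_sol_traj lam1 r (c / 2)); auto; lra).
  eapply Rle_trans; [|apply (traj_Im_lower r m w); auto; try lra].
  - rewrite E. unfold c. apply Rmult_le_compat_l; [lra|].
    assert (2 / m * r <= 2 / m * t).
    { apply Rmult_le_compat_l; [|lra]. left; apply Rdiv_lt_0_compat; lra. }
    destruct (Req_dec r t) as [->|]; [lra|].
    destruct H as [H|H]. left; apply exp_increasing; lra. rewrite H; lra.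
  - intros s Hs. apply far; auto; try lra. apply (traj_restrict lam1 s r); auto; lra. }
assert (c / 2 <= Im (w t)).
{ destruct (Rle_lt_dec (c / 2) (Im (w t))) as [|Hlt]; auto. exfalso.
  assert (c / 2 <= Im (w 0)).
  { rewrite E. assert (exp (- (2 / m * t)) <= 1).
    { rewrite <- exp_0. assert (0 <= 2 / m * t).
      { apply Rmult_le_pos; auto. left; apply Rdiv_lt_0_compat; lra. }
      destruct H as [H|H]. left; apply exp_increasing; lra. rewrite <- H, Ropp_0; lra. }
    unfold c. generalize (exp_pos (- (2 / m * t))). nra. }
  (* Falling below [c / 2] would mean taking that value at some time, where [key] forces the height
     to be at least [c]. *)
  destruct (IVT_gen (fun s => Im (w s)) 0 t (c / 2)) as (r & Hr & Er).
  - intros s. eapply is_derive_continuity. apply (Hw s).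
  - rewrite Rmin_right, Rmax_left; lra.
  - rewrite Rmin_left, Rmax_right in Hr by lra.
    specialize (key r Hr ltac:(lra)). lra. }
exists w. split; auto.
apply (cut_sol_traj lam1 t (c / 2)); auto; lra.
Qed.

End Curve.

(** * The Loewner maps *)

Lemma Cmod_diff_continuous (f : R -> C) (s : R) :
  (forall eps, 0 < eps -> exists delta, 0 < delta /\
     forall r, Rabs (r - s) < delta -> Cmod (f r - f s)%C < eps) ->
  continuous (fun r => Re (f r)) s /\ continuous (fun r => Im (f r)) s.
Proof.
intros H; split; apply (continuous_norm_intro (V := R_CompleteNormedModule));
  intros eps He; destruct (H eps He) as (d & Hd & Hs); exists d; split; auto;
  intros r Hr; (eapply Rle_lt_trans; [|exact (Hs r Hr)]).
- exact (re_le_Cmod (f r - f s)).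
- exact (Im_le_Cmod (f r - f s)).
Qed.

(** The solution is the exponential of the integral of [A], written in coordinates; as an
    exponential it never vanishes. *)
Lemma linear_ode_C (A : R -> C) :
  (forall s, continuous (fun r => Re (A r)) s) -> (forall s, continuous (fun r => Im (A r)) s) ->
  exists P : R -> C, P 0 = RtoC 1 /\ forall s, cderiv P s (A s * P s)%C /\ P s <> RtoC 0.
Proof.
intros C1 C2.
set (al s := RInt (fun r => Re (A r)) 0 s). set (be s := RInt (fun r => Im (A r)) 0 s).
assert (Da : forall s, is_derive al s (Re (A s))).
{ intros s. apply (is_derive_RInt (fun r => Re (A r)) al 0); auto.
  exists (mkposreal 1 Rlt_0_1). intros r _.
  apply (RInt_correct (V := R_CompleteNormedModule)), ex_RInt_continuous; auto. }
assert (Db : forall s, is_derive be s (Im (A s))).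
{ intros s. apply (is_derive_RInt (fun r => Im (A r)) be 0); auto.
  exists (mkposreal 1 Rlt_0_1). intros r _.
  apply (RInt_correct (V := R_CompleteNormedModule)), ex_RInt_continuous; auto. }
exists (fun s => (exp (al s) * cos (be s), exp (al s) * sin (be s))).
split.
{ unfold al, be. rewrite !RInt_point. change (@zero R_CompleteNormedModule) with 0.
  rewrite exp_0, cos_0, sin_0. unfold RtoC. f_equal; ring. }
assert (De : forall s, is_derive (fun r => exp (al r)) s (Re (A s) * exp (al s))).
{ intros s. apply (is_derive_comp (V := R_NormedModule) exp al); auto. apply is_derive_exp. }
intros s. split; [split; simpl|].
- eapply is_derive_eq.
  apply (is_derive_mult (K := R_AbsRing) (fun r => exp (al r)) (fun r => cos (be r)));
    [apply De| |exact Rmult_comm].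
  apply (is_derive_comp (V := R_NormedModule) cos be); [apply is_derive_cos|apply Db].
  unfold plus, mult, scal; simpl. unfold mult; simpl. unfold Re, Im. ring.
- eapply is_derive_eq.
  apply (is_derive_mult (K := R_AbsRing) (fun r => exp (al r)) (fun r => sin (be r)));
    [apply De| |exact Rmult_comm].
  apply (is_derive_comp (V := R_NormedModule) sin be); [apply is_derive_sin|apply Db].
  unfold plus, mult, scal; simpl. unfold mult; simpl. unfold Re, Im. ring.
- intros E. injection E as E1 E2.
  assert (P := exp_pos (al s)). generalize (sin2_cos2 (be s)). unfold Rsqr.
  assert (cos (be s) = 0) by nra. assert (sin (be s) = 0) by nra. nra.
Qed.

Lemma quadratic_error_is_derive (f : C -> C) (z d : C) (K rho : R) : 0 < rho ->
  (forall w, Cmod (w - z) < rho ->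
     Cmod (f w - f z - (w - z) * d) <= K * Cmod (w - z) ^ 2) ->
  @is_derive C_AbsRing C_NormedModule f z d.
Proof.
intros Hr H. apply is_derive_C_intro. intros eps He.
set (delta := Rmin rho (eps / (Rabs K + 1))).
assert (K0 := Rabs_pos K).
assert (Hd : 0 < delta) by (apply Rmin_pos; auto; apply Rdiv_lt_0_compat; lra).
exists (mkposreal delta Hd). intros w Hw.
change (Cmod (w - z) < delta) in Hw.
change (Cmod (f w - f z - (w - z) * d) <= eps * Cmod (w - z)).
eapply Rle_trans; [apply H|].
{ apply Rlt_le_trans with (1 := Hw), Rmin_l. }
assert (Hw2 : Cmod (w - z) < eps / (Rabs K + 1)).
{ apply Rlt_le_trans with (1 := Hw), Rmin_r. }
assert (C0 := Cmod_ge_0 (w - z)). assert (KA := Rle_abs K).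
replace (K * Cmod (w - z) ^ 2) with (K * Cmod (w - z) * Cmod (w - z)) by ring.
apply Rmult_le_compat_r; auto.
apply Rle_trans with ((Rabs K + 1) * (eps / (Rabs K + 1))).
2: right; field; lra.
apply Rle_trans with ((Rabs K + 1) * Cmod (w - z)); [nra|].
apply Rmult_le_compat_l; lra.
Qed.

Section Maps.
Context (lam lam1 : R -> R) (M : R).
Context (lam1_cont : forall s, continuous lam1 s).
Context (lam1_bound : forall s, Rabs (lam1 s) <= M).
Context (M_pos : 0 < M).
Context (lam_deriv : forall s, is_derive lam s (lam1 s)).
Context (lam_0 : lam 0 = 0).

Local Notation traj := (traj lam1).
Local Notation gam := (loewner_curve lam1).

(** At time 0 the identity is required at every complex number, also outside the half-plane; at
    other times the value is determined only where a trajectory exists. *)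
Definition loewner_map (t : R) (z : C) : C :=
  if Req_EM_T t 0 then z
  else epsilon (inhabits (RtoC 0)) (fun w => exists u, traj t u /\ u 0 = z /\ w = (u t + lam t)%C).

Local Notation g := loewner_map.

Lemma g_traj (t : R) (u : R -> C) : 0 <= t -> traj t u -> g t (u 0) = (u t + lam t)%C.
Proof.
intros t0 Hu. unfold g. destruct Req_EM_T as [->|Hn].
- rewrite lam_0. ring.
- assert (E : exists w, exists v, traj t v /\ v 0 = u 0 /\ w = (v t + lam t)%C).
  { exists (u t + lam t)%C, u. auto. }
  destruct (epsilon_spec (inhabits (RtoC 0)) _ E) as (v & Hv & Ev & ->).
  rewrite (traj_unique lam1 t v u); auto; lra.
Qed.

(** * Differentiability, normalization and image of the Loewner maps *)

Lemma lam_lip (t : R) : 0 <= t -> Rabs (lam t) <= M * t.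
Proof.
intros t0. generalize (mean_value_R lam lam1 M 0 t t0).
rewrite lam_0, !Rminus_0_r. auto.
Qed.

Lemma inv_sq_lip (delta : R) (z w : C) : 0 < delta ->
  delta <= Cmod z -> delta <= Cmod w ->
  Cmod (2 / z * / z - 2 / w * / w) <= 4 / delta ^ 3 * Cmod (z - w).
Proof.
intros Hd Hz Hw.
assert (z0 : z <> RtoC 0) by (apply Cmod_gt_0; lra).
assert (w0 : w <> RtoC 0) by (apply Cmod_gt_0; lra).
assert (D2 : RtoC 2 <> RtoC 0) by (intros E; injection E; lra).
replace (2 / z * / z - 2 / w * / w)%C with ((2 / z - 2 / w) * (2 / z + 2 / w) / 2)%C
  by (field; auto).
rewrite Cmod_div, Cmod_mult, Cmod_R, (Rabs_pos_eq 2) by (auto; lra).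
assert (A := inv_diff_bound delta z w Hd Hz Hw).
assert (B : Cmod (2 / z + 2 / w) <= 4 / delta).
{ eapply Rle_trans; [apply Cmod_triangle|]. rewrite !Cmod_two by auto.
  assert (/ Cmod z <= / delta) by now apply Rinv_le_contravar.
  assert (/ Cmod w <= / delta) by now apply Rinv_le_contravar.
  unfold Rdiv. lra. }
replace (4 / delta ^ 3 * Cmod (z - w))
  with (2 / delta ^ 2 * Cmod (z - w) * (4 / delta) / 2) by (field; lra).
apply Rmult_le_compat_r; [lra|].
apply Rmult_le_compat; auto; apply Cmod_ge_0.
Qed.

(* With P' = 2 P / u^2 and D = u_w - u_z, the product D P has derivative
   2 P D^2 / (u_z^2 u_w), quadratic in w - z; hence the derivative of the flow map is 1 / P(t). *)
Lemma loewner_map_differentiable (t : R) (u : R -> C) : 0 <= t -> traj t u ->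
  exists d, @is_derive C_AbsRing C_NormedModule (g t) (u 0) d.
Proof.
intros t0 Hu.
destruct (traj_extend lam1 M lam1_cont lam1_bound t u t0 Hu)
  as (delta & U & Hd & HU & IU & EU).
assert (UIm : forall s, 0 <= s <= t -> 2 * delta <= Im (U s)).
{ intros s Hs. rewrite IU. apply (cut_sol_Im_decr lam1 delta); auto; lra. }
assert (Utraj : traj t U) by (apply (cut_sol_traj lam1 t delta); auto; specialize (UIm t); lra).
(* The cut is inactive on [[0, t]]; it makes [A] continuous on the whole line, as the linear
   equation demands. *)
set (A s := (2 / cut delta (U s) * / cut delta (U s))%C).
assert (AC : forall s, continuous (fun r => Re (A r)) s /\ continuous (fun r => Im (A r)) s).
{ intros s. apply Cmod_diff_continuous. intros eps He.
  destruct (HU s) as [D1 D2].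
  assert (k0 : 0 < 4 / delta ^ 3) by (apply Rdiv_lt_0_compat; [lra|apply pow_lt; auto]).
  set (k := 4 / delta ^ 3) in *.
  destruct (is_derive_continuity _ _ _ D1 (eps / (2 * k))) as (d1 & Hd1 & H1).
  { apply Rdiv_lt_0_compat; lra. }
  destruct (is_derive_continuity _ _ _ D2 (eps / (2 * k))) as (d2 & Hd2 & H2).
  { apply Rdiv_lt_0_compat; lra. }
  exists (Rmin d1 d2). split. now apply Rmin_pos.
  intros r Hr. destruct (Req_dec r s) as [->|rs].
  { replace (A s - A s)%C with (RtoC 0) by ring. now rewrite Cmod_0. }
  specialize (H1 r). specialize (H2 r). simpl in H1, H2. unfold R_dist in H1, H2.
  assert (B1 : Rabs (Re (U r) - Re (U s)) < eps / (2 * k)).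
  { apply H1. split. split; auto; exact I. apply Rlt_le_trans with (1 := Hr), Rmin_l. }
  assert (B2 : Rabs (Im (U r) - Im (U s)) < eps / (2 * k)).
  { apply H2. split. split; auto; exact I. apply Rlt_le_trans with (1 := Hr), Rmin_r. }
  unfold A. eapply Rle_lt_trans.
  apply (inv_sq_lip delta); auto using cut_lower. fold k.
  apply Rle_lt_trans with (k * (Rabs (Re (U r) - Re (U s)) + Rabs (Im (U r) - Im (U s)))).
  - apply Rmult_le_compat_l; [lra|]. eapply Rle_trans; [apply cut_lip|].
    apply Cmod_le_Re_Im.
  - apply Rlt_le_trans with (k * (eps / (2 * k) + eps / (2 * k))).
    apply Rmult_lt_compat_l; lra. right; field; lra. }
destruct (linear_ode_C A) as (P & P0 & HP); try apply AC.
set (L := 2 / delta ^ 2).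
assert (L0 : 0 < L) by (apply Rdiv_lt_0_compat; [lra|apply pow_lt; auto]).
assert (PB : forall s, 0 <= s <= t -> Cmod (P s) <= exp (L * s)).
{ intros s Hs.
  destruct (gronwall_C P (fun s => A s * P s)%C (fun _ => L) (fun s => L * s) 0 s) as [G _].
  - lra.
  - intros r _. apply HP.
  - intros r _. auto_derive; auto. ring.
  - intros r _. rewrite Cmod_mult. apply Rmult_le_compat_r; [apply Cmod_ge_0|].
    unfold A. rewrite Cmod_mult, Cmod_two, Cmod_inv by now apply cut_neq_0.
    assert (0 < / Cmod (cut delta (U r)) <= / delta).
    { assert (Q := cut_lower delta (U r) Hd). split.
      apply Rinv_0_lt_compat; lra. now apply Rinv_le_contravar. }
    unfold L. replace (2 / delta ^ 2) with (2 * / delta * / delta) by (field; lra).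
    unfold Rdiv. nra.
  - rewrite P0, Cmod_1, Rmult_1_l, Rmult_0_r, Rminus_0_r in G. exact G. }
(* The mean value bound for [D P]: [|P| <= exp (L t)], [|D| <= |w - U 0| exp (L t)], and each of the
   three factors in the denominator is at least [delta]. *)
set (K := 4 * exp (L * t) * exp (L * t) ^ 2 / delta ^ 3 * t).
exists (/ P t)%C.
(* Within this radius neighbouring solutions stay within [delta] of [U], whose height is at least
   [2 * delta], so they remain above the cut. *)
apply quadratic_error_is_derive with (K / Cmod (P t)) (delta * exp (- (L * t))).
{ apply Rmult_lt_0_compat; auto. apply exp_pos. }
intros w Hw.
destruct (cut_flow lam1 M lam1_cont lam1_bound delta 0 w) as (W & W0 & HW); auto.
rewrite <- (EU 0) in * by lra. 
assert (Dep : forall s, 0 <= s <= t -> Cmod (W s - U s) <= Cmod (w - U 0) * exp (L * t)).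
{ intros s Hs. destruct (cut_flow_dep lam1 delta 0 s W U) as [D _]; auto; try lra.
  eapply Rle_trans; [exact D|]. rewrite W0.
  apply Rmult_le_compat_l; [apply Cmod_ge_0|]. fold L.
  assert (L * (s - 0) <= L * t) by (apply Rmult_le_compat_l; lra).
  destruct H as [H|H]. left; now apply exp_increasing. rewrite H; lra. }
assert (Dlt : Cmod (w - U 0) * exp (L * t) < delta).
{ rewrite exp_Ropp in Hw. assert (Q := exp_pos (L * t)).
  apply Rmult_lt_compat_r with (r := exp (L * t)) in Hw; auto.
  rewrite Rmult_assoc, Rinv_l, Rmult_1_r in Hw; lra. }
assert (WIm : forall s, 0 <= s <= t -> delta <= Im (W s)).
{ intros s Hs. generalize (UIm s Hs) (Dep s Hs) (Im_le_Cmod (W s - U s)) (Rle_abs (- Im (W s - U s))).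
  rewrite Rabs_Ropp. unfold Im; simpl. lra. }
assert (Wtraj : traj t W) by (apply (cut_sol_traj lam1 t delta); auto; apply WIm; lra).
rewrite <- W0 at 1. rewrite (g_traj t W t0 Wtraj), (g_traj t U t0 Utraj).
replace (W t + lam t - (U t + lam t) - (w - U 0) * / P t)%C
  with (((W t - U t) * P t - (w - U 0)) / P t)%C by (field; apply HP).
rewrite Cmod_div by apply HP.
replace (K / Cmod (P t) * Cmod (w - U 0) ^ 2) with (K * Cmod (w - U 0) ^ 2 / Cmod (P t)).
2: { field. apply Rgt_not_eq, Cmod_gt_0, HP. }
apply Rmult_le_compat_r. left; apply Rinv_0_lt_compat, Cmod_gt_0, HP.
assert (MV := mean_value_C (fun s => (W s - U s) * P s)%C
  (fun s => 2 * P s * ((W s - U s) * (W s - U s)) / (U s * U s * W s))%C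
  (2 * exp (L * t) * (Cmod (w - U 0) * exp (L * t)) ^ 2 / delta ^ 3) 0 t t0).
cbv beta in MV. rewrite P0, W0 in MV.
replace ((W t - U t) * P t - (w - U 0) * 1)%C with ((W t - U t) * P t - (w - U 0))%C in MV by ring.
eapply Rle_trans; [apply MV|].
- intros s Hs. destruct (Wtraj s Hs) as [PW LW], (Utraj s Hs) as [PU LU].
  eapply cderiv_eq. apply cderiv_mult.
  apply cderiv_minus; [exact LW|exact LU]. apply HP.
  unfold A. rewrite cut_id by (specialize (UIm s Hs); lra).
  field. split; apply C_neq_0_Im; auto.
- intros s Hs. destruct (Wtraj s Hs) as [PW LW], (Utraj s Hs) as [PU LU].
  rewrite Cmod_div by (repeat apply Cmult_neq_0; now apply C_neq_0_Im).
  rewrite !Cmod_mult, Cmod_R, (Rabs_pos_eq 2) by lra.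
  assert (UB : delta <= Cmod (U s)).
  { generalize (UIm s Hs) (Im_le_Cmod (U s)) (Rle_abs (Im (U s))). lra. }
  assert (WB : delta <= Cmod (W s)).
  { generalize (WIm s Hs) (Im_le_Cmod (W s)) (Rle_abs (Im (W s))). lra. }
  unfold Rdiv. apply Rmult_le_compat.
  + repeat apply Rmult_le_pos; try apply Cmod_ge_0; lra.
  + left. apply Rinv_0_lt_compat. repeat apply Rmult_lt_0_compat; lra.
  + replace ((Cmod (w - U 0) * exp (L * t)) ^ 2)
      with (Cmod (w - U 0) * exp (L * t) * (Cmod (w - U 0) * exp (L * t))) by ring.
    apply Rmult_le_compat.
    * apply Rmult_le_pos; [lra|apply Cmod_ge_0].
    * apply Rmult_le_pos; apply Cmod_ge_0.
    * apply Rmult_le_compat_l; [lra|]. eapply Rle_trans; [now apply PB|].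
      assert (L * s <= L * t) by (apply Rmult_le_compat_l; lra).
      destruct H as [H|H]. left; now apply exp_increasing. rewrite H; lra.
    * apply Rmult_le_compat; try apply Cmod_ge_0; auto.
  + apply Rinv_le_contravar. apply pow_lt; auto.
    replace (delta ^ 3) with (delta * delta * delta) by ring.
    apply Rmult_le_compat; [nra|lra|apply Rmult_le_compat; lra|lra].
- right. unfold K. field. lra.
Qed.

(** The function [g_s(z) - 2 s / z] has time derivative [2 / u - 2 / z = 2 (z - u) / (u z)]. This is
    [O(1 / |z|^2)] once [u] is shown to stay comparable to [z] in modulus and at bounded distance
    from it. *)
Lemma loewner_map_normalization (t : R) : 0 <= t ->
  exists K R0, 0 < R0 /\ forall u, traj t u -> R0 < Cmod (u 0) ->
    Cmod (g t (u 0) - u 0 - RtoC (2 * t) / u 0)%C <= K / (Cmod (u 0) ^ 2).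
Proof.
intros t0.
(* [|u|^2] decreases at rate at most [4 + 2 M |u| <= 4 + M + M |u|^2 = M (|u|^2 + c)], so
   [(|u|^2 + c) exp (M s)] increases. *)
set (c := (4 + M) / M).
assert (c0 : 0 < c) by (apply Rdiv_lt_0_compat; lra).
(* Half of the factor [exp (- M t)] is given up to absorb [c]; the radius [R0] below is large enough
   for this. *)
set (kap := sqrt (exp (- (M * t)) / 2)).
assert (EM := exp_pos (- (M * t))).
assert (k0 : 0 < kap) by (apply sqrt_lt_R0; lra).
(* The first term bounds the displacement of [g], using [1 / |z| <= 1]; the second bounds [lam]. *)
set (B := 4 * t / kap + M * t).
exists (4 * B * t / kap), (1 + 2 * c * exp (M * t)).
assert (EM' := exp_pos (M * t)).
assert (CE : 0 < c * exp (M * t)) by now apply Rmult_lt_0_compat.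
split. lra.
intros u Hu Hbig.
set (z := u 0) in *.
assert (z0 : z <> RtoC 0) by (apply Cmod_gt_0; lra).
assert (zinv : 0 < / Cmod z <= 1).
{ split. apply Rinv_0_lt_compat; lra. rewrite <- Rinv_1. apply Rinv_le_contravar; lra. }
assert (un0 : forall s, 0 <= s <= t -> u s <> RtoC 0).
{ intros s Hs. apply C_neq_0_Im. now apply Hu. }
assert (low : forall s, 0 <= s <= t -> kap * Cmod z <= Cmod (u s)).
{ intros s Hs.
  set (dN r := 2 * (Re (u r) * Re (2 / u r - lam1 r)%C + Im (u r) * Im (2 / u r - lam1 r)%C)).
  assert (D : (Cmod (u 0) ^ 2 + c) * exp (M * 0) <= (Cmod (u s) ^ 2 + c) * exp (M * s)).
  { apply (derive_ge_0_incr (fun r => (Cmod (u r) ^ 2 + c) * exp (M * r))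
      (fun r => (dN r + M * (Cmod (u r) ^ 2 + c)) * exp (M * r))); [lra| |].
    - intros r Hr. destruct (Hu r ltac:(lra)) as [_ Lr].
      eapply is_derive_eq.
      apply (is_derive_mult (K := R_AbsRing) (fun r => Cmod (u r) ^ 2 + c) (fun r => exp (M * r)));
        [|auto_derive; auto|exact Rmult_comm].
      apply (is_derive_plus (fun r => Cmod (u r) ^ 2) (fun _ => c)).
      apply is_derive_Cmod2, Lr. apply (is_derive_const c).
      fold (dN r). unfold plus, mult, zero; simpl. ring.
    - intros r Hr. apply Rmult_le_pos; [|left; apply exp_pos].
      assert (Q : Rabs (dN r) <= 4 + 2 * M * Cmod (u r)).
      { unfold dN. rewrite Rabs_mult, (Rabs_pos_eq 2) by lra.
        assert (Cmod (u r) * Cmod (2 / u r - lam1 r) <= 2 + M * Cmod (u r)).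
        { rewrite <- Cmod_mult.
          replace (u r * (2 / u r - lam1 r))%C with (2 + - (lam1 r * u r))%C
            by (field; apply un0; lra).
          eapply Rle_trans; [apply Cmod_triangle|].
          rewrite Cmod_opp, Cmod_mult, !Cmod_R, (Rabs_pos_eq 2) by lra.
          apply Rplus_le_compat_l, Rmult_le_compat_r; auto. apply Cmod_ge_0. }
        generalize (cauchy_schwarz_C (u r) (2 / u r - lam1 r)). lra. }
      apply Rabs_le_between in Q.
      assert (c * M = 4 + M) by (unfold c; field; lra).
      generalize (pow2_ge_0 (Cmod (u r) - 1)). nra. }
  fold z in D. rewrite Rmult_0_r, exp_0, Rmult_1_r in D.
  assert (exp (M * s) <= exp (M * t)).
  { assert (M * s <= M * t) by (apply Rmult_le_compat_l; lra).
    destruct H as [H|H]. left; now apply exp_increasing. rewrite H; lra. }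
  assert (Ee : exp (- (M * t)) * exp (M * t) = 1).
  { rewrite <- exp_plus, <- exp_0. f_equal; ring. }
  assert (Sq : (kap * Cmod z) ^ 2 <= Cmod (u s) ^ 2).
  { rewrite Rpow_mult_distr. unfold kap. rewrite pow2_sqrt by lra.
    assert (2 * c * exp (M * t) <= Cmod z ^ 2) by nra.
    assert (N0 := pow2_ge_0 (Cmod (u s))).
    assert (D2 : Cmod z ^ 2 <= (Cmod (u s) ^ 2 + c) * exp (M * t)) by nra.
    apply Rmult_le_reg_r with (exp (M * t)); auto.
    replace (exp (- (M * t)) / 2 * Cmod z ^ 2 * exp (M * t))
      with (exp (- (M * t)) * exp (M * t) * Cmod z ^ 2 / 2) by field.
    rewrite Ee. nra. }
  apply Rsqr_incr_0_var; [|apply Cmod_ge_0]. now rewrite !Rsqr_pow2. }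
assert (kz : 0 < kap * Cmod z) by (apply Rmult_lt_0_compat; lra).
assert (dg : forall s, 0 <= s <= t -> cderiv (fun r => u r + lam r)%C s (2 / u s)%C).
{ intros s Hs. destruct (Hu s Hs) as [_ Ls].
  eapply cderiv_eq. apply cderiv_plus. exact Ls. apply cderiv_RtoC, lam_deriv. ring. }
assert (inv_u : forall s, 0 <= s <= t -> Cmod (2 / u s) <= 2 / (kap * Cmod z)).
{ intros s Hs. rewrite Cmod_two by now apply un0.
  apply Rmult_le_compat_l; [lra|]. apply Rinv_le_contravar; auto. }
assert (near : forall s, 0 <= s <= t -> Cmod (z - u s) <= B).
{ intros s Hs.
  assert (MV := mean_value_C (fun r => u r + lam r)%C (fun r => 2 / u r)%C (2 / (kap * Cmod z)) 0 s).
  cbv beta in MV. rewrite lam_0 in MV. fold z in MV.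
  replace (z - u s)%C with (- (u s + lam s - (z + 0)) + lam s)%C by ring.
  eapply Rle_trans; [apply Cmod_triangle|]. rewrite Cmod_opp, Cmod_R.
  unfold B. apply Rplus_le_compat.
  - eapply Rle_trans; [apply MV; try lra|].
    intros r Hr. apply dg; lra. intros r Hr. apply inv_u; lra.
    rewrite Rminus_0_r.
    replace (2 * (2 / (kap * Cmod z)) * s) with (4 / kap * (s * / Cmod z)) by (field; lra).
    replace (4 * t / kap) with (4 / kap * t) by (field; lra).
    apply Rmult_le_compat_l. left; apply Rdiv_lt_0_compat; lra. nra.
  - eapply Rle_trans; [apply lam_lip; lra|]. apply Rmult_le_compat_l; lra. }
assert (MV := mean_value_C (fun r => u r + lam r - RtoC (2 * r) / z)%C
  (fun r => 2 / u r - 2 / z)%C (2 * B / (kap * Cmod z * Cmod z)) 0 t t0).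
cbv beta in MV. rewrite lam_0 in MV. fold z in MV.
assert (Eg : g t z = (u t + lam t)%C) by now apply g_traj.
rewrite Eg.
replace (u t + lam t - z - RtoC (2 * t) / z)%C
  with (u t + lam t - RtoC (2 * t) / z - (z + 0 - RtoC (2 * 0) / z))%C.
2: { rewrite Rmult_0_r. field. auto. }
eapply Rle_trans; [apply MV|].
- intros s Hs. apply cderiv_minus; [now apply dg|].
  eapply cderiv_eq. apply (cderiv_mult (fun r => RtoC (2 * r)) (fun _ => / z)%C).
  apply cderiv_RtoC with (d := 2). auto_derive; auto; ring.
  apply cderiv_const. field. auto.
- intros s Hs. rewrite inv_diff_C by auto.
  rewrite Cmod_opp, Cmod_div, !Cmod_mult, Cmod_R, (Rabs_pos_eq 2) by
    (try lra; apply Cmult_neq_0; auto).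
  unfold Rdiv. apply Rmult_le_compat.
  + generalize (Cmod_ge_0 (u s - z)); lra.
  + left. apply Rinv_0_lt_compat, Rmult_lt_0_compat; [|lra].
    specialize (low s Hs). lra.
  + rewrite <- Cmod_opp. replace (- (u s - z))%C with (z - u s)%C by ring.
    generalize (near s Hs). lra.
  + apply Rinv_le_contravar. apply Rmult_lt_0_compat; lra.
    apply Rmult_le_compat_r; [lra|auto].
- right. field. lra.
Qed.

(** Heights grow backward in time, so the equation can be solved from any end point in the
    half-plane down to time 0. *)
Lemma loewner_map_onto (t : R) (w : C) : 0 <= t -> inH w ->
  exists u, traj t u /\ (u t + lam t)%C = w.
Proof.
intros t0 Hw. red in Hw.
destruct (cut_flow lam1 M lam1_cont lam1_bound (Im w) t (w - lam t)%C) as (u & E & Hu); auto.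
exists u. split.
- apply (cut_sol_traj lam1 t (Im w)); auto. rewrite E. unfold Im; simpl. lra.
- rewrite E. ring.
Qed.

Lemma loewner_map_tip (t : R) : 0 <= t -> M ^ 2 * t <= 1 ->
  forall eps, 0 < eps -> exists delta, 0 < delta /\
    forall u, traj t u -> Cmod (u 0 - gam t) < delta -> Cmod (g t (u 0) - RtoC (lam t))%C < eps.
Proof.
intros t0 Ht eps He.
destruct (Req_dec t 0) as [->|tn].
{ exists eps. split; auto. intros u Hu Hd. rewrite (g_traj 0 u t0 Hu).
  rewrite gam_0 in Hd.
  replace (u 0 + lam 0 - lam 0)%C with (u 0 - 0)%C by ring. auto. }
(* Within distance 1 of the tip, [|z + gam t| <= 1 + 2 |gam t|] converts the distance of squares
   into a distance of points. *)
set (K := (1 + 2 * Cmod (gam t)) * exp 6).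
assert (E6 := exp_pos 6). assert (G0 := Cmod_ge_0 (gam t)).
assert (K0 : 0 < K) by (apply Rmult_lt_0_compat; lra).
exists (Rmin 1 (eps ^ 2 / K)). split.
{ apply Rmin_pos; [lra|]. apply Rdiv_lt_0_compat; auto. apply pow_lt; auto. }
intros u Hu Hd.
assert (H1 : Cmod (u 0 - gam t) < 1) by (apply Rlt_le_trans with (1 := Hd), Rmin_l).
assert (H2 : Cmod (u 0 - gam t) < eps ^ 2 / K) by (apply Rlt_le_trans with (1 := Hd), Rmin_r).
rewrite (g_traj t u t0 Hu).
replace (u t + lam t - lam t)%C with (u t) by ring.
destruct (tip_compare lam1 M lam1_bound M_pos t (gam t) u) as [_ D]; auto; try lra.
{ apply (gam_tip lam1 M); auto; lra. }
assert (D2 : Cmod (gam t * gam t - u 0 * u 0) <= Cmod (u 0 - gam t) * (1 + 2 * Cmod (gam t))).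
{ rewrite <- Cmod_opp.
  replace (- (gam t * gam t - u 0 * u 0))%C with ((u 0 - gam t) * (u 0 - gam t + 2 * gam t))%C by ring.
  rewrite Cmod_mult. apply Rmult_le_compat_l; [apply Cmod_ge_0|].
  eapply Rle_trans; [apply Cmod_triangle|].
  rewrite Cmod_mult, Cmod_R, (Rabs_pos_eq 2); lra. }
apply Rsqr_incrst_0; [|apply Cmod_ge_0|lra]. rewrite !Rsqr_pow2.
apply Rle_lt_trans with (1 := D).
apply Rle_lt_trans with (Cmod (u 0 - gam t) * K).
- unfold K. rewrite <- Rmult_assoc. apply Rmult_le_compat_r; lra.
- apply Rmult_lt_reg_r with (/ K). now apply Rinv_0_lt_compat.
  rewrite Rmult_assoc, Rinv_r, Rmult_1_r by lra. exact H2.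
Qed.

(** The map picks a trajectory separately for each time; by uniqueness a single extended solution
    [U] represents all of them for times near [t], on both sides. *)
Lemma loewner_map_time_derive (t : R) (u : R -> C) : 0 < t -> traj t u ->
  @is_derive R_AbsRing C_R_NormedModule (fun s => g s (u 0)) t
    (RtoC 2 / (g t (u 0) - RtoC (lam t)))%C.
Proof.
intros t0 Hu.
destruct (traj_extend lam1 M lam1_cont lam1_bound t u ltac:(lra) Hu)
  as (delta & U & Hd & HU & IU & EU).
rewrite <- (EU 0) by lra. clear u Hu EU.
assert (near : locally t (fun s => (U s + lam s)%C = g s (U 0))).
{ destruct (is_derive_continuity _ _ _ (proj2 (HU t)) delta Hd) as (d & Hd' & Hc).
  assert (h0 : 0 < Rmin d t) by now apply Rmin_pos.
  exists (mkposreal _ h0). intros s Hs.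
  change (Rabs (s - t) < Rmin d t) in Hs.
  assert (H1 := Rlt_le_trans _ _ _ Hs (Rmin_l _ _)).
  assert (H2 := Rlt_le_trans _ _ _ Hs (Rmin_r _ _)).
  symmetry. apply g_traj. apply Rabs_lt_between in H2; lra.
  apply (cut_sol_traj lam1 s delta); auto.
  destruct (Req_dec s t) as [->|st]; [lra|].
  assert (B : Rabs (Im (U s) - Im (U t)) < delta).
  { apply (Hc s). split. split; auto; exact I. exact H1. }
  apply Rabs_lt_between in B. lra. }
assert (Tr : traj t U) by (apply (cut_sol_traj lam1 t delta); auto; lra).
apply (is_derive_ext_loc _ _ _ _ near).
rewrite (g_traj t U ltac:(lra) Tr).
replace (U t + lam t - lam t)%C with (U t) by ring.
apply cderiv_is_derive.
destruct (Tr t ltac:(lra)) as [_ L].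
eapply cderiv_eq. apply cderiv_plus. exact L. apply cderiv_RtoC, lam_deriv. ring.
Qed.

Theorem loewner_curve_generated (tau : R) : M ^ 2 * tau <= 1 -> generated_by gam lam tau.
Proof.
intros Htau. exists g. split; [|split].
- intros z. unfold g. destruct Req_EM_T; [auto|lra].
- intros t Ht.
  assert (Mt : M ^ 2 * t <= 1) by (apply (M_sq_le M t tau); lra).
  assert (tr : forall z, slit_dom gam t z -> exists u, traj t u /\ u 0 = z).
  { intros z Hz. apply (traj_of_slit_dom lam1 M); auto; lra. }
  split; [|split; [|split; [|split; [|split]]]].
  + intros z Hz. destruct (tr z Hz) as (u & Hu & <-).
    apply loewner_map_differentiable; auto; lra.
  + intros z Hz. destruct (tr z Hz) as (u & Hu & <-).
    rewrite (g_traj t u) by (auto; lra). red.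
    destruct (Hu t) as [P _]; [lra|]. unfold Im in *; simpl. lra.
  + intros z w Hz Hw E.
    destruct (tr z Hz) as (u & Hu & <-). destruct (tr w Hw) as (v & Hv & <-).
    rewrite (g_traj t u), (g_traj t v) in E by (auto; lra).
    apply (traj_unique_end lam1 t); auto; [lra|].
    replace (u t) with (u t + lam t - lam t)%C by ring. rewrite E. ring.
  + intros w Hw. destruct (loewner_map_onto t w ltac:(lra) Hw) as (u & Hu & E).
    exists (u 0). split.
    * apply (slit_dom_of_traj lam1 M); auto; lra.
    * rewrite (g_traj t u); auto; lra.
  + destruct (loewner_map_normalization t ltac:(lra)) as (K & R0 & HR & H).
    exists K, R0. split; auto. intros z Hz. destruct (tr z Hz) as (u & Hu & <-). auto.
  + intros eps He. destruct (loewner_map_tip t ltac:(lra) Mt eps He) as (d & Hd & H).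
    exists d. split; auto. intros z Hz. destruct (tr z Hz) as (u & Hu & <-). auto.
- intros t z Ht Hz.
  assert (Mt : M ^ 2 * t <= 1) by (apply (M_sq_le M t tau); lra).
  destruct (traj_of_slit_dom lam1 M lam1_cont lam1_bound M_pos t z ltac:(lra) Mt Hz) as (u & Hu & <-).
  now apply loewner_map_time_derive.
Qed.

End Maps.

(** * The driving function *)

(** Composing with it extends data on [[0, b]] to the line by constants, preserving continuity and
    bounds. *)
Definition clamp (b t : R) : R := Rmax 0 (Rmin t b).

Lemma clamp_in (b t : R) : 0 <= b -> 0 <= clamp b t <= b.
Proof. intros Hb. unfold clamp, Rmax, Rmin. repeat destruct Rle_dec; lra. Qed.

Lemma clamp_id (b t : R) : 0 <= t <= b -> clamp b t = t.
Proof. intros Hb. unfold clamp. rewrite Rmin_left, Rmax_right; lra. Qed.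

Lemma clamp_lip (b s t : R) : 0 <= b -> Rabs (clamp b s - clamp b t) <= Rabs (s - t).
Proof.
intros Hb. unfold clamp, Rmax, Rmin, Rabs.
repeat destruct Rle_dec; repeat destruct Rcase_abs; lra.
Qed.

Lemma continuous_clamp (f : R -> R) (b t : R) : 0 <= b ->
  (forall t, 0 <= t <= b -> forall eps, 0 < eps -> exists delta, 0 < delta /\
     forall s, 0 <= s <= b -> Rabs (s - t) < delta -> Rabs (f s - f t) < eps) ->
  continuous (fun r => f (clamp b r)) t.
Proof.
intros Hb H. apply (continuous_norm_intro (V := R_CompleteNormedModule)).
intros eps He. destruct (H (clamp b t) (clamp_in b t Hb) eps He) as (d & Hd & Hs).
exists d. split; auto. intros s Hst. apply Hs. now apply clamp_in.
eapply Rle_lt_trans; [now apply clamp_lip|exact Hst].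
Qed.

Lemma continuous_R_elim (f : R -> R) (t : R) : continuous f t ->
  forall eps, 0 < eps -> exists delta, 0 < delta /\
    forall s, Rabs (s - t) < delta -> Rabs (f s - f t) < eps.
Proof. apply (continuous_norm_elim (V := R_CompleteNormedModule)). Qed.

Lemma is_derive_continuous (f : R -> R) (t d : R) : is_derive f t d -> continuous f t.
Proof. intros H. apply (ex_derive_continuous (V := R_NormedModule)). now exists d. Qed.

Lemma is_derive_primitive (f : R -> R) (t : R) : (forall s, continuous f s) ->
  is_derive (fun r => RInt f 0 r) t (f t).
Proof.
intros Hf. apply (is_derive_RInt f (fun r => RInt f 0 r) 0); auto.
exists (mkposreal 1 Rlt_0_1). intros r _.
apply (RInt_correct (V := R_CompleteNormedModule)), ex_RInt_continuous; auto.
Qed.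

(** Inversion with [1 / oo = 0], continuous on the one-point compactification away from 0. *)
Definition recip (x : Rinf) : R := match x with Some r => / r | None => 0 end.

Lemma nonzero_near_0 (T : R) (l : R -> Rinf) : 0 < T -> cont_inf_on T l -> l 0 <> Some 0 ->
  exists b, 0 < b <= T /\ forall t, 0 <= t <= b -> l t <> Some 0.
Proof.
intros HT Hl H0. specialize (Hl 0 ltac:(lra)). unfold cont_inf_at in Hl.
assert (K : exists d, 0 < d /\ forall s, 0 <= s <= T -> Rabs (s - 0) < d -> l s <> Some 0).
{ destruct (l 0) as [r|].
  - assert (r0 : r <> 0) by congruence.
    destruct (Hl (Rabs r) (Rabs_pos_lt _ r0)) as (d & Hd & Hs).
    exists d. split; auto. intros s Hs1 Hs2 E.
    destruct (Hs s Hs1 Hs2) as (r' & E' & B). rewrite E in E'. injection E' as <-.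
    rewrite Rminus_0_l, Rabs_Ropp in B. lra.
  - destruct (Hl 0) as (d & Hd & Hs).
    exists d. split; auto. intros s Hs1 Hs2 E.
    destruct (Hs s Hs1 Hs2) as [E'|(r' & E' & B)]; rewrite E in E'; [discriminate|].
    injection E' as <-. rewrite Rabs_R0 in B. lra. }
destruct K as (d & Hd & K).
exists (Rmin (d / 2) T). split; [split|].
- apply Rmin_pos; lra.
- apply Rmin_r.
- intros t [t0 Ht].
  assert (t <= d / 2) by (eapply Rle_trans; [exact Ht|apply Rmin_l]).
  assert (t <= T) by (eapply Rle_trans; [exact Ht|apply Rmin_r]).
  apply K; [lra|]. rewrite Rminus_0_r, Rabs_pos_eq; lra.
Qed.

Lemma recip_continuous (T b : R) (l : R -> Rinf) : b <= T -> cont_inf_on T l ->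
  (forall t, 0 <= t <= b -> l t <> Some 0) ->
  forall t, 0 <= t <= b -> forall eps, 0 < eps -> exists delta, 0 < delta /\
    forall s, 0 <= s <= b -> Rabs (s - t) < delta -> Rabs (recip (l s) - recip (l t)) < eps.
Proof.
intros bT Hl Hn t Ht eps He.
specialize (Hl t ltac:(lra)). specialize (Hn t Ht). unfold cont_inf_at in Hl.
destruct (l t) as [r|].
(* The half of [|r|] keeps [r'] off 0, so that [|1 / r' - 1 / r| <= 2 |r' - r| / r^2]; the other
   bound on [|r' - r|] then beats [eps]. *)
- assert (r0 : 0 < Rabs r) by (apply Rabs_pos_lt; congruence).
  destruct (Hl (Rmin (Rabs r / 2) (eps * Rabs r ^ 2 / 4))) as (d & Hd & Hs).
  { apply Rmin_pos; [lra|]. generalize (pow_lt _ 2 r0). nra. }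
  exists d. split; auto. intros s Hs1 Hs2.
  destruct (Hs s ltac:(lra) Hs2) as (r' & -> & B). simpl.
  assert (B1 := Rlt_le_trans _ _ _ B (Rmin_l _ _)).
  assert (B2 := Rlt_le_trans _ _ _ B (Rmin_r _ _)).
  assert (r1 : Rabs r / 2 <= Rabs r').
  { generalize (Rabs_triang (r - r') r'). replace (r - r' + r') with r by ring.
    rewrite (Rabs_minus_sym r). lra. }
  assert (rn : r <> 0) by (intros ->; rewrite Rabs_R0 in r0; lra).
  assert (rn' : r' <> 0) by (intros ->; rewrite Rabs_R0 in r1; lra).
  replace (/ r' - / r) with (- (r' - r) * / (r' * r)) by (field; auto).
  rewrite Rabs_mult, Rabs_Ropp, Rabs_inv, Rabs_mult.
  apply Rmult_lt_reg_r with (Rabs r' * Rabs r).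
  { apply Rmult_lt_0_compat; lra. }
  rewrite Rmult_assoc, Rinv_l by (apply Rgt_not_eq, Rmult_lt_0_compat; lra).
  assert (0 <= eps * Rabs r * (Rabs r' - Rabs r / 2)) by (apply Rmult_le_pos; [apply Rmult_le_pos|]; lra).
  assert (0 < eps * (Rabs r * Rabs r)) by (apply Rmult_lt_0_compat; [|apply Rmult_lt_0_compat]; lra).
  simpl in B2. nra.
- destruct (Hl (/ eps)) as (d & Hd & Hs).
  exists d. split; auto. intros s Hs1 Hs2.
  destruct (Hs s ltac:(lra) Hs2) as [->|(r' & -> & B)]; simpl.
  + rewrite Rminus_0_r, Rabs_R0. auto.
  + rewrite Rminus_0_r. assert (0 < / eps) by now apply Rinv_0_lt_compat.
    rewrite Rabs_inv. rewrite <- (Rinv_inv eps).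
    apply Rinv_lt_contravar; auto. apply Rmult_lt_0_compat; lra.
Qed.

(** Derivatives relative to [[0, b)] may be read off another function that agrees there. The clamped
    [lam1] need not be differentiable at 0 from both sides, but [mu] is. *)
Lemma has_deriv_on_intro (f h f' : R -> R) (b : R) :
  (forall t, 0 <= t < b -> is_derive h t (f' t)) -> (forall t, 0 <= t < b -> f t = h t) ->
  has_deriv_on f f' 0 b.
Proof.
intros Hd Hf t Ht eps He.
destruct (is_derive_R_elim _ _ _ (Hd t Ht) eps He) as (d & Hs).
exists d. split; [apply cond_pos|]. intros s Hs1 Hs2.
rewrite !Hf by auto. rewrite (Rmult_comm (f' t)). exact (Hs s Hs2).
Qed.

Lemma is_derive_inv_sqrt (c d' t : R) (D : R -> R) : 0 < D t -> is_derive D t d' ->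
  is_derive (fun s => c / sqrt (D s)) t (- (c * d' / (2 * D t * sqrt (D t)))).
Proof.
intros HD Hd.
assert (S0 : 0 < sqrt (D t)) by now apply sqrt_lt_R0.
eapply is_derive_eq.
apply (is_derive_comp (V := R_NormedModule) (fun x => c / sqrt x) D); [|exact Hd].
auto_derive. split; auto. split; auto. lra. reflexivity.
unfold scal; simpl. unfold mult; simpl.
replace (2 * D t * sqrt (D t)) with (2 * (sqrt (D t) * sqrt (D t)) * sqrt (D t))
  by (rewrite sqrt_sqrt; lra).
field. lra.
Qed.

Theorem theorem4p7 (T : R) (l : R -> Rinf) (a : R) :
  0 < T ->
  cont_inf_on T l ->
  l 0 <> Some 0 ->
  a <> 0 ->
  exists tau : R, 0 < tau /\ tau <= T /\
    exists (gam : R -> Complex.C) (lam lam1 lam2 : R -> R),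
      curve_H gam tau /\
      generated_by gam lam tau /\
      C2_on lam lam1 lam2 tau /\
      lam1 0 <> 0 /\
      (forall t, 0 < t < tau -> LC_value (lam1 t) (lam2 t) = l t) /\
      2 / 3 * lam1 0 = a.
Proof.
intros HT Hl H0 Ha.
destruct (nonzero_near_0 T l HT Hl H0) as (b & Hb & Hn).
set (m t := recip (l (clamp b t))).
assert (Cm : forall t, continuous m t).
{ intros t. apply (continuous_clamp (fun r => recip (l r))); [lra|].
  apply (recip_continuous T); auto; lra. }
(* The initial slope that the prescribed scale [2 / 3 * lam1 0 = a] forces. *)
set (mu0 := 3 / 2 * a).
assert (mu0n : mu0 <> 0) by (unfold mu0; lra).
set (D t := 1 - 2 * mu0 ^ 2 * RInt m 0 t).
assert (dD : forall t, is_derive D t (- (2 * mu0 ^ 2 * m t))).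
{ intros t. eapply is_derive_eq.
  apply (is_derive_minus (fun _ => 1) (fun t => 2 * mu0 ^ 2 * RInt m 0 t)).
  apply (is_derive_const 1).
  apply (is_derive_scal (fun t => RInt m 0 t)). now apply is_derive_primitive.
  unfold minus, plus, opp, zero; simpl. ring. }
assert (D0 : D 0 = 1).
{ unfold D. rewrite RInt_point. change (@zero R_CompleteNormedModule) with 0. ring. }
(* The level 1/4 gives [sqrt (D t) >= 1 / 2], hence the bound [2 * Rabs mu0] chosen as [M]. *)
assert (near : exists c, 0 < c <= b /\ forall t, 0 <= t <= c -> 1 / 4 <= D t).
{ destruct (continuous_R_elim D 0 (is_derive_continuous _ _ _ (dD 0)) (1 / 2)) as (d & Hd & Hs).
  lra.
  exists (Rmin (d / 2) b). split; [split|].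
  - apply Rmin_pos; lra.
  - apply Rmin_r.
  - intros t [t0 Ht].
    assert (t <= d / 2) by (eapply Rle_trans; [exact Ht|apply Rmin_l]).
    specialize (Hs t). rewrite D0, Rminus_0_r, Rabs_pos_eq in Hs by auto.
    specialize (Hs ltac:(lra)). apply Rabs_lt_between in Hs. lra. }
destruct near as (c & Hc & HD).
set (mu t := mu0 / sqrt (D t)).
assert (sqD : forall t, 0 <= t <= c -> 1 / 2 <= sqrt (D t)).
{ intros t Ht. replace (1 / 2) with (sqrt ((1 / 2) ^ 2)) by (apply sqrt_pow2; lra).
  apply sqrt_le_1_alt. specialize (HD t Ht). lra. }
(* This is the curvature equation solved for the second derivative, with [m = 1 / l]. *)
set (lam2 t := mu t ^ 3 * m t).
assert (dmu : forall t, 0 <= t <= c -> is_derive mu t (lam2 t)).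
{ intros t Ht. specialize (HD t Ht). specialize (sqD t Ht).
  eapply is_derive_eq. apply is_derive_inv_sqrt; [lra|apply dD].
  unfold lam2, mu.
  replace (2 * D t * sqrt (D t)) with (2 * (sqrt (D t) * sqrt (D t)) * sqrt (D t))
    by (rewrite sqrt_sqrt; lra).
  field. lra. }
set (lam1 t := mu (clamp c t)).
set (M := 2 * Rabs mu0).
assert (M_pos : 0 < M) by (generalize (Rabs_pos_lt _ mu0n); unfold M; lra).
assert (C1 : forall t, continuous lam1 t).
{ intros t. apply continuous_clamp; [lra|]. intros s Hs eps He.
  destruct (continuous_R_elim mu s (is_derive_continuous _ _ _ (dmu s Hs)) eps He) as (d & Hd & H).
  exists d. split; auto. }
assert (B1 : forall t, Rabs (lam1 t) <= M).
{ intros t. unfold lam1, mu, M. specialize (sqD _ (clamp_in c t ltac:(lra))).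
  unfold Rdiv. rewrite Rabs_mult, Rmult_comm.
  apply Rmult_le_compat_r; [apply Rabs_pos|].
  rewrite Rabs_inv, Rabs_pos_eq by lra.
  replace 2 with (/ (1 / 2)) by field. apply Rinv_le_contravar; lra. }
set (lam t := RInt lam1 0 t : R).
assert (dlam : forall t, is_derive lam t (lam1 t)) by (intros t; now apply is_derive_primitive).
assert (lam0 : lam 0 = 0) by exact (RInt_point (V := R_CompleteNormedModule) 0 lam1).
(* Up to [c] the curvature equation is solved; up to [1 / M ^ 2] the driving function generates a
   simple curve. *)
set (tau := Rmin c (/ M ^ 2)).
assert (M2 : 0 < M ^ 2) by now apply pow_lt.
assert (tau0 : 0 < tau) by (apply Rmin_pos; [lra|now apply Rinv_0_lt_compat]).
assert (tauc : tau <= c) by apply Rmin_l.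
assert (tauM : M ^ 2 * tau <= 1).
{ apply Rle_trans with (M ^ 2 * / M ^ 2).
  apply Rmult_le_compat_l; [lra|apply Rmin_r]. right; field; lra. }
assert (lam1_mu : forall t, 0 <= t <= c -> lam1 t = mu t).
{ intros t Ht. unfold lam1. now rewrite clamp_id. }
exists tau. split; [auto|split; [lra|]].
exists (loewner_curve lam1), lam, lam1, lam2.
assert (mu_0 : lam1 0 = mu0).
{ rewrite lam1_mu by lra. unfold mu. rewrite D0, sqrt_1. field. }
split; [|split; [|split; [|split; [|split]]]].
- now apply (curve_H_gam lam1 M).
- now apply (loewner_curve_generated lam lam1 M).
- split; [|split].
  + apply (has_deriv_on_intro lam lam); auto.
  + apply (has_deriv_on_intro lam1 mu); intros t Ht; [apply dmu|apply lam1_mu]; lra.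
  + intros t Ht eps He.
    destruct (continuous_R_elim lam2 t) with (eps := eps) as (d & Hd & H); auto.
    { unfold lam2. apply (continuous_mult (K := R_AbsRing) (fun t => mu t ^ 3) m); auto.
      apply (is_derive_continuous _ _ _ (is_derive_pow mu 3 t _ (dmu t ltac:(lra)))). }
    exists d. split; auto.
- now rewrite mu_0.
- intros t Ht.
  assert (mun : mu t <> 0).
  { unfold mu, Rdiv. apply Rmult_integral_contrapositive. split; auto.
    specialize (sqD t ltac:(lra)). apply Rinv_neq_0_compat. lra. }
  rewrite lam1_mu by lra. unfold LC_value, lam2, m. rewrite clamp_id by lra.
  specialize (Hn t ltac:(lra)).
  destruct (l t) as [r|]; simpl recip.
  + assert (rn : r <> 0) by congruence.
    destruct (Req_EM_T (mu t ^ 3 * / r) 0) as [E|_].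
    * exfalso. revert E. apply Rmult_integral_contrapositive. split.
      now apply pow_nonzero. now apply Rinv_neq_0_compat.
    * f_equal. field. auto.
  (* Here [l t] is infinite: the second derivative vanishes, and the nonzero slope selects [None]
     rather than the convention [0 / 0 = 0]. *)
  + destruct (Req_EM_T (mu t ^ 3 * 0) 0) as [_|E]; [|exfalso; apply E; ring].
    destruct (Req_EM_T (mu t) 0); [contradiction|auto].
- rewrite mu_0. unfold mu0. field.
Qed.
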